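(* There is a deterministic online algorithm for the online firefighting game on $1$-almost trees that is $(6\sqrt{n}+1)$-competitive, where $n$ is the number of vertices of the input graph. This is asymptotically optimal: no deterministic online algorithm is $o(\sqrt{n})$-competitive on $1$-almost trees.
   Context: Online firefighting game: an instance is $\mathcal{I} = (G, r, (f_i)_{i\ge 1})$, where $G$ is a finite undirected graph with $n$ vertices, $r \in V(G)$ is the fire source, and $f_i \ge 0$ are integers. The graph $G$ and $r$ are known to the algorithm in advance; $f_i$ is revealed only at the beginning of round $i$. Initially only $r$ is burning. In round $i$, after learning $f_i$, the algorithm assigns at most $f_i$ firefighters to vertices that are neither burning nor already protected (a protected vertex never burns); then the fire spreads from every burning vertex to all of its unprotected neighbours. A vertex is saved if it never burns. $\mathrm{ALG}(\mathcal{I})$ is the number of vertices saved by algorithm ALG, and $\mathrm{OPT}(\mathcal{I})$ the maximum number of vertices that can be saved by any strategy knowing the whole sequence $(f_i)$ in advance. A deterministic online algorithm makes its round-$i$ decisions as a deterministic function of $G, r, f_1,\dots,f_i$. An algorithm is $c$-competitive (where $c$ may depend on $n$) on a graph class if $\mathrm{OPT}(\mathcal{I})/\mathrm{ALG}(\mathcal{I}) \le c$ for every instance whose graph is in the class and has $n$ vertices. A $1$-almost tree is a connected graph containing at most one simple cycle. *)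

(* Defs.v *)
From HB Require Import structures.
From mathcomp Require Import all_boot all_order all_algebra.
From mathcomp Require Import boolp reals topology normedtype landau.
Import Order.TTheory GRing.Theory Num.Theory numFieldNormedType.Exports.

Set Implicit Arguments.
Unset Strict Implicit.
Unset Printing Implicit Defensive.

Record sgraph := SGraph {
  svertex :> finType;
  adj : rel svertex;
  adj_sym : symmetric adj;
  adj_irrefl : irreflexive adj }.

Definition graph_connected (G : sgraph) := forall x y : G, connect (@adj G) x y.

(* [c] lists the vertices of a cycle once around, from some starting point and
   in one of the two directions. *)
Definition simple_cycle (G : sgraph) (c : seq G) :=
  ucycle (@adj G) c /\ 3 <= size c.

(* Two listings describe the same cycle of the graph exactly when they have
   the same edges. *)
Definition cycle_edges (G : sgraph) (c : seq G) : {set {set G}} :=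
  [set [set x; next c x] | x in c].

Definition one_almost_tree (G : sgraph) :=
  graph_connected G /\
  forall c1 c2 : seq G, simple_cycle c1 -> simple_cycle c2 ->
    cycle_edges c1 = cycle_edges c2.

(* Rounds are numbered from 0: [f i] is the number of firefighters revealed at
   the beginning of the [i.+1]-st round, and [D i] is the set of vertices they
   are assigned to in that round. *)
Section Game.
Variables (G : sgraph) (r : G).
Implicit Types (f : nat -> nat) (D : nat -> {set G}).

(* Vertices protected during the first [i] rounds. *)
Definition protected D (i : nat) : {set G} := \bigcup_(j < i) D j.

(* Vertices burning after [i] complete rounds. *)
Fixpoint burning D (i : nat) : {set G} :=
  if i is j.+1 then
    burning D j :|:
      [set v | (v \notin protected D j.+1)
               && [exists u in burning D j, adj u v]]
  else [set r].

Definition legal f D :=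
  forall i, [/\ #|D i| <= f i,
                [disjoint D i & burning D i]
              & [disjoint D i & protected D i]].

Definition saved D : {set G} := [set v | `[< forall i, v \notin burning D i >]].

Definition OPT f : nat :=
  \max_(k < #|G|.+1 | `[< exists2 D, legal f D & #|saved D| = k >]) k.

End Game.

(* [A G r [:: f_1; ...; f_i]] is the set of vertices to which [A] assigns
   firefighters in the [i]-th round. *)
Definition online_algorithm := forall G : sgraph, G -> seq nat -> {set G}.

Definition play (A : online_algorithm) (G : sgraph) (r : G) (f : nat -> nat)
  : nat -> {set G} := fun i => A G r (mkseq f i.+1).

Definition ALG (A : online_algorithm) (G : sgraph) (r : G) (f : nat -> nat)
  : nat := #|saved r (play A r f)|.

Definition legal_on (C : sgraph -> Prop) (A : online_algorithm) :=
  forall G : sgraph, C G -> forall (r : G) (f : nat -> nat),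
    legal r f (play A r f).

(* [OPT / ALG <= c] is cleared of its denominator: when [ALG] is 0, it holds
   exactly if [OPT] is 0 too. *)
Definition competitive_on (R : realType) (C : sgraph -> Prop)
    (A : online_algorithm) (c : nat -> R) :=
  forall G : sgraph, C G -> forall (r : G) (f : nat -> nat),
    ((OPT r f)%:R <= c #|G| * (ALG A r f)%:R)%R.

(* Main.v *)
(* Upper bound: fix a breadth-first tree with depth function [d]; at most one edge
   [a b] of the graph is missing from it. Let [t0] be the first round with a
   firefighter, and let [M] be the largest number of vertices that a single
   firefighter can save then. If [n <= M ^ 2], saving these [M] vertices is enough.
   Otherwise we show OPT <= (6 M + 1) ALG. A vertex unburnt at time [t] is either
   deeper than [t], hence unburnt in every play, or has a guarded ancestor. So if
   every subtree has at most [M] vertices, any algorithm that uses its firefighters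
   as long as it can will do. A larger subtree means that the fire is about to
   enter the two sides of the cycle. The algorithm then guards the first vertex
   of one side and uses its second firefighter at the front of the fire coming
   from the other side, thus saving as many cycle vertices as possible, each of
   which stands for at most [M] vertices. The vertices behind the burnt part of
   the cycle can burn late, depending on the side guarded first; their numbers
   are comparable, up to a factor [3 M], at all later times for one choice of the
   side.

   Lower bound: a cycle of about [k ^ 2] vertices through the root, with a path of
   [k] vertices attached to the root. The first firefighter either
   does not protect the path, and no other one comes, or protects it, and then a
   second one comes that could have saved the cycle. *)
Require Import Defs.
From mathcomp Require Import all_boot all_order all_algebra.
From mathcomp Require Import boolp reals topology normedtype landau.
From mathcomp Require Import zify lra.
Import Order.TTheory GRing.Theory Num.Theory numFieldNormedType.Exports.

Set Implicit Arguments.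
Unset Strict Implicit.
Unset Printing Implicit Defensive.

(** * Spread of the fire *)

Section Fire.
Variables (G : sgraph) (r : G).
Implicit Types (f : nat -> nat) (D : nat -> {set G}) (X : {set G}).

Lemma protectedP D i v :
  reflect (exists2 j, j < i & v \in D j) (v \in protected D i).
Proof.
apply: (iffP bigcupP) => [[j _ vj]|[j lt_ji vj]]; first by exists j.
by exists (Ordinal lt_ji).
Qed.

Lemma protected_mono D i j : i <= j -> protected D i \subset protected D j.
Proof.
move=> le_ij; apply/subsetP => v /protectedP [k lt_ki vk].
by apply/protectedP; exists k => //; apply: leq_trans le_ij.
Qed.

Lemma burningSP D i v :
  reflect (v \in burning r D i \/
           v \notin protected D i.+1 /\ exists2 u, u \in burning r D i & adj u v)
          (v \in burning r D i.+1).
Proof.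
rewrite /= in_setU inE; apply: (iffP orP) => -[].
- by left.
- by case/andP=> vP /existsP [u /andP [uB uv]]; right; split=> //; exists u.
- by left.
- by case=> vP [u uB uv]; right; rewrite vP; apply/existsP; exists u; rewrite uB.
Qed.

Lemma burning_mono D i j : i <= j -> burning r D i \subset burning r D j.
Proof.
move=> /subnK <-; elim: (j - i) => [|k IHk] //.
by apply: subset_trans IHk _; rewrite addSn; apply: subsetUl.
Qed.

Lemma burning_root D i : r \in burning r D i.
Proof. by apply: (subsetP (burning_mono D (leq0n i))); rewrite inE. Qed.

Lemma burning_step D s t u v :
  u \in burning r D s -> adj u v -> v \notin protected D t -> s < t ->
  v \in burning r D s.+1.
Proof.
move=> uB uv vP lt_st; apply/burningSP; right; split; last by exists u.
by apply: contraNN vP => /(subsetP (protected_mono D lt_st)).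
Qed.

Lemma savedP D v : reflect (forall i, v \notin burning r D i) (v \in saved r D).
Proof. by rewrite inE; apply: asboolP. Qed.

(** Fire could enter [X] only along an edge leaving [X], and the end of that edge in [X] is already
    protected when the fire spreads from [burning r D s], hence at all later times. *)
Lemma saved_barrier D X s :
  [disjoint X & burning r D s] ->
  (forall x y, x \in X -> x \notin protected D s.+1 -> adj x y -> y \in X) ->
  X \subset saved r D.
Proof.
move=> XB Xcl; apply/subsetP => v vX; apply/savedP => i.
suff dis k : [disjoint X & burning r D (s + k)].
  have /(disjointFr) /(_ vX) := dis i; move/negbT; apply: contraNN.
  by apply: (subsetP (burning_mono D _)); rewrite leq_addl.
elim: k => [|k IHk]; first by rewrite addn0.
rewrite addnS disjoint_sym; apply/pred0P => x /=; apply/negbTE/negP.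
case/andP => /burningSP xB xX.
case: xB => [xB|[xP [u uB ux]]]; first by rewrite (disjointFr IHk) in xB.
have uX : u \in X.
  apply: (Xcl x) => //; last by rewrite adj_sym.
  by apply: contraNN xP; apply/subsetP/protected_mono; rewrite ltnS leq_addr.
by rewrite (disjointFr IHk) in uB.
Qed.

Lemma protected_saved f D k : legal r f D -> D k \subset saved r D.
Proof.
move=> /(_ k) [_ DB _].
apply: saved_barrier DB _ => x y xD; case/negP.
by apply/protectedP; exists k.
Qed.

Lemma protected_sub_saved f D k : legal r f D -> protected D k \subset saved r D.
Proof.
move=> legD; apply/subsetP => v /protectedP [j _].
exact/subsetP/(protected_saved j legD).
Qed.

Lemma burning_potential D (phi : G -> nat) :
  phi r = 0 ->
  (forall k x y, phi x <= k -> adj x y -> y \notin protected D k.+1 ->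
     phi y <= k.+1) ->
  forall k x, x \in burning r D k -> phi x <= k.
Proof.
move=> phi0 phiS; elim=> [|k IHk] x; first by rewrite inE => /eqP ->; rewrite phi0.
case/burningSP => [/IHk /leqW //|[xP [u /IHk phiu ux]]].
exact: phiS phiu ux xP.
Qed.

Lemma burning_stable D :
  exists N, forall t, N <= t -> forall x, x \notin burning r D t -> x \in saved r D.
Proof.
have /fin_all_exists [h hP] (x : G) : exists i, x \notin saved r D -> x \in burning r D i.
  case: (boolP (x \in saved r D)) => [_|/savedP /existsNP [i /negP]]; first by exists 0.
  by rewrite negbK => xi; exists i.
exists (\max_x h x) => t le_t x; apply: contraNT => /hP.
by apply/subsetP/burning_mono/leq_trans/le_t; apply: (leq_bigmax x).
Qed.

Lemma card_protected f D i :
  legal r f D -> #|protected D i| <= \sum_(s < i) f s.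
Proof.
move=> legD; rewrite /protected.
elim: i => [|i IHi]; first by rewrite !big_ord0 cards0.
rewrite !big_ord_recr /=; apply: leq_trans (leq_card_setU _ _) _.
by apply: leq_add IHi _; case: (legD i).
Qed.

Lemma sum_card_protected f D i :
  legal r f D -> #|protected D i| = \sum_(s < i) #|D s|.
Proof.
move=> legD; rewrite /protected.
elim: i => [|i IHi]; first by rewrite !big_ord0 cards0.
rewrite !big_ord_recr /= cardsU -IHi.
have [_ _] := legD i; rewrite -setI_eq0 setIC => /eqP; rewrite /protected => ->.
by rewrite cards0 subn0.
Qed.

End Fire.

(** The depth of a vertex is the number of rounds after which it burns when nothing is ever
    protected; its parent is a neighbour from which that fire reaches it. *)
Lemma bfs_tree (G : sgraph) (r : G) : graph_connected G ->
  exists (d : G -> nat) (par : G -> G),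
    [/\ d r = 0,
        forall x, x != r -> adj (par x) x /\ d x = (d (par x)).+1
      & forall x y, adj x y -> d y <= (d x).+1].
Proof.
move=> conG; pose B := burning r (fun=> set0 : {set G}).
have P0 i : protected (fun=> set0 : {set G}) i = set0.
  by rewrite /protected big1.
have exB x : exists i, x \in B i.
  case/connectP: (conG r x) => p; elim/last_ind: p x => [|p y IHp] x.
    by move=> _ ->; exists 0; apply: burning_root.
  rewrite rcons_path last_rcons => /andP [pP py] ->.
  have [i Bi] := IHp _ pP erefl; exists i.+1.
  by apply: (burning_step (t := i.+1) Bi) => //; rewrite P0 inE.
pose d x := ex_minn (exB x).
have dP x : x \in B (d x) by rewrite /d; case: ex_minnP.
have d_min x i : x \in B i -> d x <= i.
  by move=> xi; rewrite /d; case: ex_minnP => m _; apply.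
have d_adj x y : adj x y -> d y <= (d x).+1.
  move=> xy; apply: d_min; apply: (burning_step (t := (d x).+1) (dP x)) => //.
  by rewrite P0 inE.
have ex_par x : exists y, x != r -> adj y x /\ d x = (d y).+1.
  have [->|xr] := eqVneq x r; first by exists r.
  case dx: (d x) => [|k].
    by have := dP x; rewrite dx /B inE => /eqP xr'; rewrite xr' eqxx in xr.
  have := dP x; rewrite dx => /burningSP [xk|[_ [u uB ux]]].
    by have := d_min _ _ xk; rewrite dx ltnn.
  exists u => _; split=> //; have := d_adj _ _ ux; have := d_min _ _ uB.
  by rewrite dx; lia.
have /fin_all_exists [par parP] := ex_par.
exists d, par; split=> //.
by apply/eqP; rewrite -leqn0; apply: d_min; rewrite inE.
Qed.

(** * The edge outside the breadth-first tree *)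

Definition tree_edge (T : eqType) (r : T) (par : T -> T) : rel T :=
  fun x y => (x != r) && (par x == y) || (y != r) && (par y == x).

Lemma set2_inj (T : finType) (x y z w : T) :
  [set x; y] = [set z; w] -> x = z /\ y = w \/ x = w /\ y = z.
Proof.
move=> xy.
have : (x \in [set z; w]) && (y \in [set z; w]) by rewrite -xy set21 set22.
have : (z \in [set x; y]) && (w \in [set x; y]) by rewrite xy set21 set22.
rewrite !inE => /andP [zP wP] /andP [/orP [] /eqP xE /orP [] /eqP yE]; auto.
- by move: wP; rewrite xE yE orbb => /eqP ->; left.
- by move: zP; rewrite xE yE orbb => /eqP ->; left.
Qed.

Lemma mem_cycle_edges (G : sgraph) (e : rel G) (c : seq G) (x y : G) :
  cycle e c -> [set x; y] \in cycle_edges c -> e x y \/ e y x.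
Proof.
move=> ec /imsetP [z zc xy].
have ez := next_cycle ec zc.
case: (set2_inj xy) => -[-> ->]; by [left|right].
Qed.

(** An edge outside the tree closes a fundamental cycle that contains no other such edge. All cycles
    have the same edges, so a second edge outside the tree would lie on this one. *)
Lemma extra_edge_uniq (G : sgraph) (r : G) (d : G -> nat) (par : G -> G) :
  one_almost_tree G -> d r = 0 ->
  (forall x, x != r -> adj (par x) x /\ d x = (d (par x)).+1) ->
  forall x y x' y', adj x y -> ~~ tree_edge r par x y ->
    adj x' y' -> ~~ tree_edge r par x' y' ->
    x' = x /\ y' = y \/ x' = y /\ y' = x.
Proof.
move=> [_ cycG] d0 parP; set T := tree_edge r par.
have Tsym : symmetric T by move=> x y; rewrite /T /tree_edge orbC.
have Tadj x y : T x y -> adj x y.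
  by case/orP => /andP [/parP [xy _] /eqP <-] //; rewrite adj_sym.
have Tr x : connect T r x.
  elim/ltn_ind: (d x) {-2}x (erefl (d x)) => n IHn {}x dx.
  have [->|xr] := eqVneq x r; first exact: connect0.
  have [_ dp] := parP _ xr.
  apply: (connect_trans (IHn (d (par x)) _ _ erefl)); first by rewrite -dx dp.
  by apply: connect1; rewrite /T /tree_edge xr eqxx orbT.
have Tconn x y : connect T x y.
  by apply: connect_trans (Tr y); rewrite (sym_connect_sym Tsym).
have fundamental x y : adj x y -> ~~ T x y -> exists2 c, simple_cycle c &
    [set x; y] \in cycle_edges c /\
    cycle (fun u v => T u v || (u == y) && (v == x)) c.
  move=> xy nxy; have /connectP [p0 /shortenP [p pT up _] ly] := Tconn x y.
  have yp : last x p = y by [].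
  have yx : y != x by apply: contraTneq xy => ->; rewrite adj_irrefl.
  exists (x :: p).
    split; last first.
      (* The tree path has at least three vertices, because [x] and [y] are distinct and not joined
         by a tree edge. *)
      case: p pT up ly yp => [|z [|z' p]] //=; first by move=> _ _ _ xy'; rewrite -xy' eqxx in yx.
      by rewrite andbT => xz _ _ zy; rewrite -zy xz in nxy.
    apply/andP; split => //=; rewrite rcons_path yp adj_sym xy andbT.
    by apply: sub_path pT => u v /Tadj.
  split.
    apply/imsetP; exists y; first by rewrite -yp mem_last.
    rewrite setUC; congr [set _; _].
    rewrite -yp next_nth mem_last index_last // nth_default //.
  rewrite /= rcons_path yp !eqxx orbT andbT.
  by apply: sub_path pT => u v ->.
move=> x y x' y' xy nxy xy' nxy'.
have [c sc [xyc ec]] := fundamental _ _ xy nxy.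
have [c' sc' [xyc' ec']] := fundamental _ _ xy' nxy'.
rewrite -(cycG _ _ sc sc') in xyc'.
have := mem_cycle_edges ec xyc'.
rewrite (negbTE nxy') [T y' x']Tsym (negbTE nxy') /=.
by case=> /andP [/eqP -> /eqP ->]; [right|left].
Qed.

Lemma card_bigcup_leq (I T : finType) (A : {set I}) (F : I -> {set T}) m :
  (forall i, i \in A -> #|F i| <= m) -> #|\bigcup_(i in A) F i| <= #|A| * m.
Proof.
move=> leF; rewrite -sum_nat_const.
apply: (@leq_trans (\sum_(i in A) #|F i|)); last exact: leq_sum.
elim/big_rec2: _ => [|i X k _ IH]; first by rewrite cards0.
by apply: leq_trans (leq_card_setU _ _) _; rewrite leq_add2l.
Qed.

(** * Algorithms following a priority list *)

(* Up to [k] elements of [A], those listed in [s] first. *)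
Fixpoint pick_first (T : finType) (s : seq T) (A : {set T}) (k : nat) : {set T} :=
  if k is k'.+1 then
    if [seq x <- s ++ enum T | x \in A] is x :: _
    then x |: pick_first s (A :\ x) k' else set0
  else set0.

Section PickFirst.
Variable T : finType.
Implicit Types (s : seq T) (A : {set T}).

Lemma pick_first_ind s (Q : nat -> {set T} -> {set T} -> Prop) :
  (forall A, Q 0 A set0) ->
  (forall k, Q k set0 set0) ->
  (forall k x A, x \in A -> Q k (A :\ x) (pick_first s (A :\ x) k) ->
     Q k.+1 A (x |: pick_first s (A :\ x) k)) ->
  forall k A, Q k A (pick_first s A k).
Proof.
move=> Q0 Qnil QS; elim=> [|k IHk] A //=.
case E: [seq x <- s ++ enum T | x \in A] => [|x l].
  have -> : A = set0; last exact: Qnil.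
  apply/setP => x; rewrite inE; apply/negP => xA.
  suff : x \in [::] by [].
  by rewrite -E mem_filter xA mem_cat mem_enum orbT.
apply: QS => //; have : x \in x :: l by rewrite mem_head.
by rewrite -E mem_filter => /andP [].
Qed.

Lemma pick_first_sub s A k : pick_first s A k \subset A.
Proof.
move: k A; apply: (pick_first_ind (Q := fun _ A X => X \subset A)) => [A|_|k x A xA IH];
  rewrite ?sub0set //.
by rewrite subUset sub1set xA (subset_trans IH) // subsetDl.
Qed.

Lemma card_pick_first s A k : #|pick_first s A k| = minn k #|A|.
Proof.
move: k A; apply: (pick_first_ind (Q := fun k A X => #|X| = minn k #|A|)) =>
  [A|k|k x A xA IH]; rewrite ?cards0 ?min0n ?minn0 //.
rewrite cardsU1 IH (cardsD1 x A) xA minnSS.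
have -> // : x \notin pick_first s (A :\ x) k.
by apply: contraTN isT => /(subsetP (pick_first_sub _ _ _)); rewrite !inE eqxx.
Qed.

Lemma pick_first_exhausted s A k : #|pick_first s A k| < k -> pick_first s A k = A.
Proof.
rewrite card_pick_first gtn_min ltnn /= => lt_Ak.
apply/eqP; rewrite eqEcard pick_first_sub card_pick_first.
by rewrite (minn_idPr (ltnW lt_Ak)) leqnn.
Qed.

Lemma pick_first_head v s A k : 0 < k -> v \in A -> v \in pick_first (v :: s) A k.
Proof. by case: k => // k _ vA; rewrite /= vA setU11. Qed.

(** The number [(v \in A)] is 1 exactly when [v] takes a firefighter before [q] is considered. *)
Lemma pick_first_second v q s A k :
  (v \in A) < k -> q \in A -> q \in pick_first (v :: q :: s) A k.
Proof.
case: k => // k; rewrite /=; case: (boolP (v \in A)) => [vA|vA] /= lt_k qA.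
  have [->|qv] := eqVneq q v; first by rewrite setU11.
  case: k lt_k => // k _; rewrite inE /= !inE eqxx qv qA /=.
  by rewrite !inE eqxx orbT.
by rewrite qA setU11.
Qed.

End PickFirst.

Section Strategy.
Variables (G : sgraph) (r : G) (sigma : seq nat -> seq G).

(** A move depends on the position reached by the earlier moves, so the protected and the burning
    vertices are computed together, round by round. *)
Fixpoint state (f : nat -> nat) (i : nat) : {set G} * {set G} :=
  if i is j.+1 then
    let: (P, B) := state f j in
    let P' := P :|: pick_first (sigma (mkseq f j.+1)) (~: (P :|: B)) (f j) in
    (P', B :|: [set v | (v \notin P') && [exists u in B, adj u v]])
  else (set0, [set r]).

Definition move (f : nat -> nat) (i : nat) : {set G} :=
  pick_first (sigma (mkseq f i.+1)) (~: ((state f i).1 :|: (state f i).2)) (f i).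

Lemma stateE f i : state f i = (protected (move f) i, burning r (move f) i).
Proof.
elim: i => [|i IHi]; first by rewrite /= /protected big_ord0.
have PS : protected (move f) i.+1 = protected (move f) i :|: move f i.
  by rewrite /protected big_ord_recr.
by rewrite /= PS /move IHi /=.
Qed.

Lemma moveE f i : move f i =
  pick_first (sigma (mkseq f i.+1))
    (~: (protected (move f) i :|: burning r (move f) i)) (f i).
Proof. by rewrite {1}/move stateE. Qed.

Lemma eq_state f g i : (forall j, j < i -> f j = g j) -> state f i = state g i.
Proof.
elim: i => [|i IHi] fg //=; rewrite IHi => [|j lt_ji]; last by apply: fg; apply: ltnW.
rewrite fg // (_ : mkseq f i.+1 = mkseq g i.+1) //.
by apply/eq_in_map => j; rewrite mem_iota add0n => /andP [_ /fg].
Qed.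

Lemma eq_move f g i : (forall j, j <= i -> f j = g j) -> move f i = move g i.
Proof.
move=> fg; rewrite /move (eq_state (g := g)) => [|j /ltnW /fg //]; rewrite fg //.
rewrite (_ : mkseq f i.+1 = mkseq g i.+1) //.
by apply/eq_in_map => j; rewrite mem_iota add0n => /andP [_ /fg].
Qed.

Lemma move_legal f : legal r f (move f).
Proof.
move=> i; rewrite {1}moveE card_pick_first geq_minl.
have := pick_first_sub (sigma (mkseq f i.+1))
  (~: (protected (move f) i :|: burning r (move f) i)) (f i).
rewrite -moveE => sub; split=> //; rewrite disjoints_subset;
  by apply: subset_trans sub _; rewrite setCS ?subsetUl ?subsetUr.
Qed.

End Strategy.

(** The revealed list is continued by zeros to a full sequence; by [eq_move] the move of the current
    round [(size s).-1] is independent of the continuation. *)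
Definition priority_algorithm (sigma : forall G : sgraph, G -> seq nat -> seq G) :
  online_algorithm :=
  fun G r s => move r (sigma G r) (nth 0 s) (size s).-1.

Lemma play_priority (sigma : forall G : sgraph, G -> seq nat -> seq G)
    (G : sgraph) (r : G) f :
  play (priority_algorithm sigma) r f = move r (sigma G r) f.
Proof.
apply/funext => i; rewrite /play /priority_algorithm size_mkseq /=.
by apply: eq_move => j lt_ji; rewrite nth_mkseq.
Qed.

(** * Ancestors and common ancestors in the breadth-first tree *)

Section Tree.
Variables (G : sgraph) (r : G) (d : G -> nat) (par : G -> G).
Hypothesis d_root : d r = 0.
Hypothesis parP : forall x, x != r -> adj (par x) x /\ d x = (d (par x)).+1.

Hypothesis d_adj : forall x y, adj x y -> d y <= (d x).+1.

Lemma d_par x : x != r -> d x = (d (par x)).+1.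
Proof. by case/parP. Qed.

Lemma d_gt0 x : (0 < d x) = (x != r).
Proof. by have [->|/d_par ->] := eqVneq x r; rewrite ?d_root. Qed.

Lemma d_eq0 x : d x = 0 -> x = r.
Proof. by move=> dx; apply/eqP; apply: contraTT isT; rewrite -d_gt0 dx. Qed.

Definition lev x j := iter (d x - j) par x.

Lemma d_iter k x : k <= d x -> d (iter k par x) = d x - k.
Proof.
elim: k => [|k IHk] lt_k; first by rewrite subn0.
rewrite iterS; have := IHk (ltnW lt_k); set y := iter k par x => dy.
have /d_par : y != r by rewrite -d_gt0 dy subn_gt0.
by rewrite dy; lia.
Qed.

Lemma d_lev x j : j <= d x -> d (lev x j) = j.
Proof. by move=> le_j; rewrite d_iter ?leq_subr // subKn. Qed.

Lemma lev_d x : lev x (d x) = x.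
Proof. by rewrite /lev subnn. Qed.

Lemma lev0 x : lev x 0 = r.
Proof. by apply: d_eq0; rewrite d_lev. Qed.

Lemma lev_lev x i j : j <= i -> i <= d x -> lev (lev x i) j = lev x j.
Proof.
move=> le_ji le_ix; rewrite {1}/lev d_lev // /lev -iterD; congr iter; lia.
Qed.

Lemma lev_par x j : x != r -> j <= d (par x) -> lev (par x) j = lev x j.
Proof.
by move=> xr le_j; rewrite /lev (d_par xr) subSn // -iterSr.
Qed.

Definition anc p x := (d p <= d x) && (lev x (d p) == p).

Lemma ancP p x : reflect (d p <= d x /\ lev x (d p) = p) (anc p x).
Proof. by apply: (iffP andP) => -[? /eqP ?]. Qed.

Lemma anc_le p x : anc p x -> d p <= d x.
Proof. by case/andP. Qed.

Lemma anc_refl x : anc x x.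
Proof. by rewrite /anc leqnn lev_d eqxx. Qed.

Lemma anc_lev x j : j <= d x -> anc (lev x j) x.
Proof. by move=> le_j; rewrite /anc d_lev // le_j eqxx. Qed.

Lemma anc_trans : transitive anc.
Proof.
move=> y x z /ancP [xy lx] /ancP [yz ly]; apply/ancP; split; first exact: leq_trans yz.
by rewrite -{2}lx -ly lev_lev // d_lev.
Qed.

Lemma anc_total p q x : anc p x -> anc q x -> d p <= d q -> anc p q.
Proof.
move=> /ancP [px lp] /ancP [qx lq] pq; apply/ancP; split=> //.
by rewrite -{1}lq lev_lev.
Qed.

Lemma anc_par p x : anc p x -> x != p -> anc p (par x).
Proof.
move=> /ancP [px lp] xp.
have lt_px : d p < d x.
  by rewrite ltn_neqAle px andbT; apply: contraNneq xp => dp; rewrite -lp dp lev_d.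
have xr : x != r by rewrite -d_gt0 (leq_ltn_trans _ lt_px).
have le_p : d p <= d (par x) by move: lt_px; rewrite (d_par xr).
by apply/ancP; rewrite lev_par.
Qed.

Lemma anc_child p x : x != r -> anc p (par x) -> anc p x.
Proof.
move=> xr /ancP [px lp]; apply/ancP.
by rewrite -lev_par // (d_par xr) leqW.
Qed.

(* The depth of the lowest common ancestor of [a] and [x]. *)
Definition meet a x := \max_(j < (minn (d x) (d a)).+1 | lev x j == lev a j) j.

(** Ancestors that coincide at one depth coincide at all smaller depths, so the depths up to the
    maximum are exactly those of the common ancestors. *)
Lemma leq_meet a x j :
  (j <= meet a x) = [&& j <= d x, j <= d a & lev x j == lev a j].
Proof.
have [k /eqP lk ek] : exists2 k : 'I_(minn (d x) (d a)).+1,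
    lev x k == lev a k & meet a x = k.
  have := @eq_bigmax_cond _ (fun k : 'I_(minn (d x) (d a)).+1 => lev x k == lev a k)
    (fun k => k : nat); case.
    by apply/card_gt0P; exists ord0; rewrite unfold_in !lev0.
  by move=> k lk ek; exists k.
apply/idP/and3P => [|[jx ja lj]].
  rewrite ek => le_jk; have := ltn_ord k; rewrite ltnS leq_min => /andP [kx ka].
  split; try lia; rewrite -(lev_lev le_jk kx) -(lev_lev le_jk ka).
  by rewrite lk.
have lt_j : j < (minn (d x) (d a)).+1 by rewrite ltnS leq_min jx.
exact: (leq_bigmax_cond (Ordinal lt_j)).
Qed.

Lemma meet_le a x : meet a x <= d x.
Proof. by have := leq_meet a x (meet a x); rewrite leqnn => /esym/and3P []. Qed.

Lemma meet_le_l a x : meet a x <= d a.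
Proof. by have := leq_meet a x (meet a x); rewrite leqnn => /esym/and3P []. Qed.

Lemma lev_meet a x j : j <= meet a x -> lev x j = lev a j.
Proof. by rewrite leq_meet => /and3P [_ _ /eqP]. Qed.

Lemma meet_self a : meet a a = d a.
Proof. by apply/eqP; rewrite eqn_leq meet_le leq_meet leqnn /=. Qed.

Lemma meet_par a x : x != r -> meet a (par x) = minn (meet a x) (d (par x)).
Proof.
move=> xr; apply/eqP; rewrite eqn_leq; apply/andP; split.
  rewrite leq_min meet_le andbT leq_meet; apply/and3P; split.
  - by rewrite (d_par xr) leqW // meet_le.
  - exact: meet_le_l.
  - by rewrite -lev_par ?meet_le //; apply/eqP/lev_meet.
rewrite leq_meet; apply/and3P; split.
- exact: geq_minr.
- by apply: leq_trans (geq_minl _ _) (meet_le_l _ _).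
- by rewrite lev_par ?geq_minr //; apply/eqP/lev_meet/geq_minl.
Qed.

Lemma meet_top a x : meet a x = d x -> x = lev a (d x).
Proof. by move=> mx; rewrite -(@lev_meet a x) ?lev_d ?mx. Qed.

Lemma meet_lev a j : j <= d a -> meet a (lev a j) = j.
Proof.
move=> ja; apply/eqP; rewrite eqn_leq -{2}(d_lev ja) meet_le /=.
by rewrite leq_meet d_lev // leqnn ja lev_lev /=.
Qed.

Lemma meet_lev_deep a x j : meet a x <= j -> j <= d x -> meet a (lev x j) = meet a x.
Proof.
move=> mj jx; apply/eqP; rewrite eqn_leq; apply/andP; split.
  have le_mj : meet a (lev x j) <= j by rewrite -{2}(d_lev jx) meet_le.
  rewrite leq_meet (leq_trans le_mj jx) meet_le_l /=.
  by rewrite -(lev_lev le_mj jx) (lev_meet (leqnn (meet a (lev x j)))).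
by rewrite leq_meet d_lev // mj meet_le_l /= lev_lev // (lev_meet (leqnn (meet a x))).
Qed.

Lemma meet_anc a x j : j <= d a -> anc (lev a j) x = (j <= meet a x).
Proof. by move=> ja; rewrite leq_meet ja /= /anc d_lev //. Qed.

(** * Fire along the tree when no firefighter comes before round [t0] *)

Variables (t0 : nat) (f : nat -> nat).
Hypothesis f_t0 : forall i, i < t0 -> f i = 0.
Implicit Types (a b c p u x y : G) (D : nat -> {set G}) (X : {set G}).

Lemma burning_depth D k x : x \in burning r D k -> d x <= k.
Proof.
apply: burning_potential => // {}k {}x y xk /d_adj yx _.
exact: leq_trans yx _.
Qed.

(** The fire follows the tree path from [x] to [u], one vertex a round, as no guard stands on it
    beyond [x]; [burn_up] is the same in the other direction. *)
Lemma burn_down D s t x u :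
  x \in burning r D s -> anc x u ->
  (forall y, anc x y -> anc y u -> y != x -> y \notin protected D t) ->
  s + (d u - d x) <= t -> u \in burning r D (s + (d u - d x)).
Proof.
move=> xs; have [n] := ubnP (d u); elim: n u => // n IHn u lt_n xu free le_t.
have [->|ux] := eqVneq u x; first by rewrite subnn addn0.
have ur : u != r.
  by apply: contraNneq ux => uE; rewrite uE in xu *; case/ancP: xu;
    rewrite d_root leqn0 => /eqP /d_eq0 ->.
have du := d_par ur.
have xpu := anc_par xu ux.
have dxpu := anc_le xpu.
have pu : par u \in burning r D (s + (d (par u) - d x)).
  apply: IHn => //; last by move: le_t; rewrite du; clear; lia.
    by rewrite -ltnS -du.
  by move=> y xy yu; apply: free => //; apply: (anc_child ur yu).
have [adju _] := parP ur.
have -> : s + (d u - d x) = (s + (d (par u) - d x)).+1 by lia.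
apply: (burning_step pu adju (t := t)); last by lia.
by apply: free => //; rewrite anc_refl.
Qed.

Lemma burn_up D s t x c :
  x \in burning r D s -> anc c x ->
  (forall y, anc c y -> anc y x -> y != x -> y \notin protected D t) ->
  s + (d x - d c) <= t -> c \in burning r D (s + (d x - d c)).
Proof.
have [n] := ubnP (d x); elim: n x s => // n IHn x s lt_n xs cx free le_t.
have [<-|xc] := eqVneq x c; first by rewrite subnn addn0.
have xr : x != r.
  by apply: contraNneq xc => xE; rewrite xE in cx *; case/ancP: cx;
    rewrite d_root leqn0 => /eqP /d_eq0 ->.
have dx := d_par xr.
have cpx := anc_par cx xc.
have dcpx := anc_le cpx.
have pxx : anc (par x) x by apply: anc_child => //; rewrite anc_refl.
have -> : s + (d x - d c) = s.+1 + (d (par x) - d c) by lia.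
have [adjx _] := parP xr; rewrite adj_sym in adjx.
apply: IHn => //; last by move: le_t dcpx; rewrite dx; clear; lia.
- by rewrite -ltnS -dx.
- apply: (burning_step xs adjx (t := t)); last by lia.
  by apply: free => //; apply/eqP => E; move: dx; rewrite E; lia.
- move=> y cy ypx yx; apply: free => //; first exact: (anc_trans ypx pxx).
  by apply/eqP => E; have := anc_le ypx; rewrite E dx ltnn.
Qed.

Lemma anc_root x : anc r x.
Proof. by apply/ancP; rewrite d_root lev0. Qed.

Lemma burning_natural D t u :
  d u <= t -> (forall p, p \in protected D t -> ~~ anc p u) ->
  u \in burning r D (d u).
Proof.
move=> du free.
have := @burn_down D 0 t r u (burning_root _ _ _) (anc_root u).
rewrite d_root subn0 add0n; apply=> // y _ yu _.
by apply: contraTN yu => /free.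
Qed.

Lemma unburnt_guarded D t u :
  d u <= t -> u \notin burning r D t -> exists2 p, p \in protected D t & anc p u.
Proof.
move=> du unb; have [/exists_inP [p pP pu]|no] := boolP [exists p in protected D t, anc p u].
  by exists p.
case/negP: unb; apply: (subsetP (burning_mono r D du)).
apply: burning_natural (du) _ => p pP; apply: contraNN no => pu.
by apply/exists_inP; exists p.
Qed.

(** With no guard before round [t0], every vertex of depth at most [t0] is burning when the first
    firefighter is placed. *)
Lemma protected_deep D t p :
  legal r f D -> p \in protected D t -> t0 < d p.
Proof.
move=> legD /protectedP [s _ ps]; rewrite ltnNge; apply/negP => dp.
have [Df DB _] := legD s.
have le_s : t0 <= s.
  rewrite leqNgt; apply/negP => /f_t0 fs; move: Df; rewrite fs leqn0 cards_eq0 => /eqP D0.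
  by rewrite D0 inE in ps.
have /(unburnt_guarded dp) [q qP _] : p \notin burning r D t0.
  have := disjointFr DB ps; move/negbT; apply: contraNN.
  exact/subsetP/burning_mono.
have := card_protected t0 legD; rewrite big1 ?leqn0 ?cards_eq0 => [/eqP E|i _].
  by rewrite E inE in qP.
exact: f_t0.
Qed.

(* A firefighter at [p] saves [X] if the fire has not gone deeper than [t0]. *)
Definition core p X :=
  [/\ p \in X, forall x, x \in X -> t0 < d x
    & forall x y, x \in X -> x != p -> adj x y -> y \in X].

Lemma core_saved D p X : core p X -> p \in D t0 -> X \subset saved r D.
Proof.
move=> [_ deepX clX] pD; apply: (saved_barrier (s := t0)).
  apply/pred0P => x /=; apply/negbTE/negP => /andP [/deepX xd /burning_depth].
  by rewrite leqNgt xd.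
move=> x y xX xP; apply: clX => //; apply: contraNneq xP => ->.
by apply/protectedP; exists t0.
Qed.

Definition desc p := [set x | anc p x].

(* [D] is the play of the algorithm with priority list [prio i] in round [i]. *)
Definition follows (prio : nat -> seq G) D :=
  forall i, t0 <= i ->
    D i = pick_first (prio i) (~: (protected D i :|: burning r D i)) (f i).

(** Let [t] be the first round in which a firefighter stays idle: all vertices not burning are then
    protected. If there is none before the fire has stopped spreading, take a round [t] from which
    on nothing new burns. *)
Lemma exhausted prio D : legal r f D -> follows prio D ->
  exists t, [/\ t0 <= t, forall x, x \notin burning r D t -> x \in saved r D
                & forall s, s < t -> #|D s| = f s].
Proof.
move=> legD folD; have [N NP] := burning_stable r D.
have [all_used|] := boolP [forall s : 'I_(maxn t0 N), #|D s| == f s].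
  exists (maxn t0 N); split=> [|x|s lt_s]; first exact: leq_maxl.
    by apply: NP; apply: leq_maxr.
  by have /forallP /(_ (Ordinal lt_s)) /eqP := all_used.
rewrite negb_forall => /existsP [s1 Ds1].
have exs : exists s, #|D s| < f s.
  by exists s1; rewrite ltn_neqAle Ds1; case: (legD s1).
pose t := ex_minn exs; have [Dt t_min] : #|D t| < f t /\ forall s, #|D s| < f s -> t <= s.
  by rewrite /t; case: ex_minnP.
have le_t : t0 <= t by rewrite leqNgt; apply: contraTN Dt => /f_t0 ->.
exists t; split=> // [x xB|s lt_s].
  have DE := folD t le_t.
  have := pick_first_exhausted; move/(_ _ (prio t) _ (f t)).
  move/(_ (~: (protected D t :|: burning r D t))); rewrite -DE => /(_ Dt) DtE.
  have [xP|xP] := boolP (x \in protected D t).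
    exact: (subsetP (protected_sub_saved t legD)).
  by apply: (subsetP (protected_saved t legD)); rewrite DtE !inE negb_or xP.
apply/eqP; rewrite eqn_leq; have [-> _ _] := legD s.
by rewrite leqNgt; apply/negP => /t_min; rewrite leqNgt lt_s.
Qed.

Lemma card_opt_protected D D' t :
  legal r f D -> legal r f D' -> (forall s, s < t -> #|D s| = f s) ->
  #|protected D' t| <= #|saved r D|.
Proof.
move=> legD legD' Df; apply: leq_trans (card_protected t legD') _.
have -> : \sum_(s < t) f s = \sum_(s < t) #|D s| by apply: eq_bigr => s _; rewrite Df.
by rewrite -(sum_card_protected t legD) subset_leq_card // (protected_sub_saved _ legD).
Qed.

Lemma desc_bound prio D D' M :
  legal r f D -> follows prio D -> legal r f D' ->
  (forall p, t0 < d p -> #|desc p| <= M) ->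
  #|saved r D'| <= M.+1 * #|saved r D|.
Proof.
move=> legD folD legD' leM; have [t [le_t unb Df]] := exhausted legD folD.
have cover : saved r D' \subset
    [set x | t < d x] :|: \bigcup_(p in protected D' t) desc p.
  apply/subsetP => u /savedP /(_ t) ub; rewrite !inE; case: ltnP => //= du.
  by have [p pP pu] := unburnt_guarded du ub; apply/bigcupP; exists p; rewrite ?inE.
apply: leq_trans (subset_leq_card cover) _.
apply: leq_trans (leq_card_setU _ _) _; rewrite mulSn leq_add //.
  apply/subset_leq_card/subsetP => x; rewrite inE => xt; apply: unb.
  by apply: contraTN xt => /burning_depth; rewrite -leqNgt.
rewrite mulnC; apply: leq_trans (card_bigcup_leq (m := M) _) _.
  by move=> p /(protected_deep legD') /leM.
by rewrite leq_mul2r (card_opt_protected legD legD') // orbT.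
Qed.

(** * A fire about to go round the cycle *)

Lemma meetC a b : meet a b = meet b a.
Proof.
have le_meet x y : meet x y <= meet y x.
  rewrite leq_meet // meet_le_l meet_le /=.
  by rewrite -(lev_meet (leqnn _)).
by apply/eqP; rewrite eqn_leq !le_meet.
Qed.

Lemma anc_anc_meet v a b : anc v a -> anc v b -> d v <= meet a b.
Proof.
move=> /ancP [va la] /ancP [vb lb].
by rewrite leq_meet // va vb la lb /=.
Qed.

(* The fire, having reached depth [t0], has burnt the top of the cycle that
   the only edge [a b] outside the tree closes, but neither [a] nor [b]. *)
Definition spine a b :=
  [/\ adj a b,
      forall x y, adj x y ->
        [\/ tree_edge r par x y, x = a /\ y = b | x = b /\ y = a],
      t0 < d a, t0 < d b & meet a b <= t0].

Lemma spine_sym a b : spine a b -> spine b a.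
Proof.
move=> [ab ext da db mab]; split; rewrite ?(adj_sym b) 1?meetC //.
by move=> x y /ext [] ?; [constructor 1|constructor 3|constructor 2].
Qed.

(** Otherwise [a] and [b] would have a common ancestor deeper than [t0]. So a vertex hangs below at
    most one of the two sides of the cycle. *)
Lemma spine_excl a b x : spine a b -> t0 < meet a x -> meet b x <= t0.
Proof.
move=> [_ _ da db mab] ma; rewrite leqNgt; apply/negP => mb.
have la := lev_meet ma; have lb := lev_meet mb.
by move: mab; rewrite leqNgt leq_meet // da db -la lb eqxx.
Qed.

Lemma spine_depth a b : spine a b -> d a <= (d b).+1 /\ d b <= (d a).+1.
Proof. by move=> [ab _ _ _ _]; split; apply: d_adj => //; rewrite adj_sym. Qed.

Lemma spine_edge a b x y : spine a b -> adj x y ->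
  [\/ [/\ x != r, par x = y, d x = (d y).+1, meet a y = minn (meet a x) (d y)
        & meet b y = minn (meet b x) (d y)],
      [/\ y != r, par y = x, d y = (d x).+1, meet a x = minn (meet a y) (d x)
        & meet b x = minn (meet b y) (d x)],
      x = a /\ y = b | x = b /\ y = a].
Proof.
move=> [_ ext _ _ _] /ext [|[-> ->]|[-> ->]]; last 2 first.
- by constructor 3.
- by constructor 4.
case/orP => /andP [nr /eqP <-]; [constructor 1|constructor 2];
  by rewrite !meet_par //; split=> //; case: (parP nr).
Qed.

(** The second value is the length of a walk from the root down to [b], over the edge [b a], up to
    the ancestor of [x] at depth [meet a x], the foot of [x], and down to [x]. *)
Definition psi a b x :=
  if meet a x <= t0 then d x else (d a + d b).+1 + d x - 2 * meet a x.

(* The vertices that do not burn before round [t] when the vertex of depth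
   [t0.+1] above [a] is guarded: the fire then reaches the rest of that side
   of the cycle through the edge [b a], after [psi] rounds. *)
Definition late a b t := [set x | (meet a x == t0.+1) || (t < psi a b x)].

(** The formula for [psi] changes along a tree edge only if one end has foot at depth [t0.+1], which
    is excluded. At the edge [a b] the values are [(d b).+1] and [d b]. *)
Lemma psi_adj a b x y : spine a b -> adj x y ->
  meet a x != t0.+1 -> meet a y != t0.+1 -> psi a b y <= (psi a b x).+1.
Proof.
move=> sp xy; have [dab dba] := spine_depth sp; have [_ _ da db mab] := sp.
have [mx my] := (meet_le_l a x, meet_le_l a y).
have [mx' my'] := (meet_le a x, meet_le a y).
rewrite /psi; case: (spine_edge sp xy) => [[_ _ dx mp _]|[_ _ dy mp _]|[xE yE]|[xE yE]].
- by case: (leqP (meet a x) t0); case: (leqP (meet a y) t0); lia.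
- by case: (leqP (meet a x) t0); case: (leqP (meet a y) t0); lia.
- by subst x y; rewrite meet_self // mab; case: (leqP (d a) t0); lia.
- by subst x y; rewrite meet_self // mab; case: (leqP (d a) t0); lia.
Qed.

Lemma psi_ge a b x : spine a b -> d x <= psi a b x.
Proof.
move=> /spine_depth [dab _]; rewrite /psi; case: (leqP (meet a x) t0) => // _.
by have := meet_le_l a x; lia.
Qed.

Definition chain a lo hi := [set lev a (lo + i).+1 | i : 'I_(hi - lo)].

Lemma chainP a lo hi x :
  reflect (exists j, [/\ lo < j, j <= hi & x = lev a j]) (x \in chain a lo hi).
Proof.
apply: (iffP imsetP) => [[i _ ->]|[j [lt_j le_j ->]]].
  by exists (lo + i).+1; split=> //; have := ltn_ord i; lia.
have lt_i : j - lo.+1 < hi - lo by lia.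
by exists (Ordinal lt_i) => //=; congr lev; lia.
Qed.

Lemma card_chain a lo hi : hi <= d a -> #|chain a lo hi| = hi - lo.
Proof.
move=> le_hi; rewrite card_imset ?card_ord // => i j /(congr1 d).
have [li lj] := (ltn_ord i, ltn_ord j).
by rewrite !d_lev //; try lia; move=> eij; apply: val_inj => /=; lia.
Qed.

Lemma card_chain_le a lo hi : #|chain a lo hi| <= hi - lo.
Proof. by apply: leq_trans (leq_imset_card _ _) _; rewrite card_ord. Qed.

(** By [spine_excl] no vertex deeper than [t0] lies above both [a] and [b], so the two pieces of the
    cycle are disjoint. *)
Lemma two_chains a b lo hi lo' hi' X : spine a b ->
  hi <= d a -> hi' <= d b -> t0 <= lo -> t0 <= lo' ->
  (forall j, lo < j -> j <= hi -> lev a j \in X) ->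
  (forall j, lo' < j -> j <= hi' -> lev b j \in X) ->
  (hi - lo) + (hi' - lo') <= #|X|.
Proof.
move=> sp le_hi le_hi' le_lo le_lo' aX bX.
rewrite -(card_chain lo le_hi) -(card_chain lo' le_hi').
have dis : chain a lo hi :&: chain b lo' hi' = set0.
  apply/setP => x; rewrite !inE; apply/negP.
  case/andP => /chainP [j [lt_j le_j xj]] /chainP [k [lt_k le_k xk]].
  have := @spine_excl a b x sp; rewrite {1}xj xk !meet_lev //; try lia.
rewrite -[X in X <= _]subn0 -(cards0 G) -dis -cardsU.
apply/subset_leq_card/subsetP => x; rewrite inE.
by case/orP => /chainP [j [lt_j le_j ->]]; [apply: aX|apply: bX].
Qed.

(** The part of the subtree of [c] that is reached without following the cycle further down; it is
    the whole subtree if [c] is above neither [a] nor [b]. *)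
Definition hang a b c := [set x | [&& anc c x, meet a x <= d c & meet b x <= d c]].

(** Tree edges leave the set only at [c]. The edge [a b] does too: [meet a a = d a], so [a] can be
    in the set only if it is [c], and likewise [b]. *)
Lemma hang_core a b c : spine a b -> t0 < d c -> core c (hang a b c).
Proof.
move=> sp dc; split.
- by rewrite inE anc_refl !meet_le.
- by move=> x; rewrite inE => /andP [/anc_le cx _]; apply: leq_trans cx.
move=> x y; rewrite !inE => /and3P [cx ma mb] xc xy.
have lt_cx : d c < d x.
  rewrite ltn_neqAle (anc_le cx) andbT; apply: contraNneq xc => dcx.
  by case/ancP: cx => _ <-; rewrite dcx lev_d.
case: (spine_edge sp xy) => [[xr <- dx ea eb]|[yr px dy ea eb]|[xE yE]|[xE yE]].
- rewrite anc_par //=; lia.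
- rewrite anc_child ?px //=; lia.
- by move: ma lt_cx; rewrite xE meet_self //; lia.
- by move: mb lt_cx; rewrite xE meet_self //; lia.
Qed.

Definition foot_core a j := [set x | meet a x == j].

Lemma foot_core_hang a b j : spine a b -> t0 < j -> j <= d a ->
  foot_core a j \subset hang a b (lev a j).
Proof.
move=> sp lt_j le_j; apply/subsetP => x; rewrite !inE => /eqP mx.
rewrite meet_anc // d_lev // mx leqnn /=.
by apply: leq_trans (ltnW lt_j); apply: spine_excl sp _; rewrite mx.
Qed.

(** * What the play saves after guarding the side of [a] *)

Section Guarded.
Variables (a b : G) (D : nat -> {set G}).
Hypotheses (sp : spine a b) (guard : lev a t0.+1 \in D t0).

Lemma guard_saved x : meet a x = t0.+1 -> x \in saved r D.
Proof.
move=> mx; have [_ _ da _ _] := sp.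
have := core_saved (hang_core sp (c := lev a t0.+1) _) guard.
rewrite d_lev // => /(_ (ltnSn _)) /subsetP; apply.
by apply: (subsetP (foot_core_hang sp (ltnSn t0) da)); rewrite inE mx.
Qed.

(** The guard saves all vertices with foot at depth [t0.+1], so the fire uses only edges on which
    [psi] grows by at most one. *)
Lemma burning_psi k x :
  x \in burning r D k -> meet a x != t0.+1 /\ psi a b x <= k.
Proof.
have unsaved i z : z \in burning r D i -> meet a z != t0.+1.
  by move=> zi; apply: contraTneq zi => /guard_saved /savedP.
move=> xk; split; first exact: unsaved xk.
elim: k x xk => [|k IHk] x.
  rewrite inE => /eqP ->; rewrite /psi d_root.
  by have := meet_le a r; rewrite d_root leqn0 => /eqP ->.
move=> xk; have mx := unsaved _ _ xk; case/burningSP: xk => [/IHk /leqW //|[_ [y yk yx]]].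
by apply: leq_trans (psi_adj sp yx (unsaved _ _ yk) mx) _; rewrite ltnS IHk.
Qed.

Lemma late_saved t : (forall x, x \notin burning r D t -> x \in saved r D) ->
  late a b t \subset saved r D.
Proof.
move=> unb; apply/subsetP => x; rewrite inE => /orP [/eqP /guard_saved //|lt_t].
by apply: unb; apply: contraTN lt_t => /burning_psi [_]; rewrite -leqNgt.
Qed.

(* Guarding this vertex in round [t] closes off the part of the cycle that the
   fire coming through [b] has not reached. *)
Definition front t := if t < d b then lev b t.+1 else lev a (d a + d b - t).

(** In both cases [psi] takes the value [t.+1] at [front t]. *)
Lemma front_unburnt t : t0 <= t -> t0.+1 < d a + d b - t ->
  front t \notin burning r D t.
Proof.
move=> le_t lt_t; have [dab dba] := spine_depth sp; have [_ _ da db mab] := sp.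
apply/negP => /burning_psi []; rewrite /front /psi; case: ltnP => lt_tb _.
  have /(spine_excl (spine_sym sp)) -> : t0 < meet b (lev b t.+1) by rewrite meet_lev //; lia.
  by rewrite d_lev ?ltnn.
rewrite meet_lev ?d_lev //; try lia; case: (leqP _ t0); lia.
Qed.

Lemma front_saved t : t0 <= t ->
  (t0.+1 < d a + d b - t -> front t \in protected D t.+1) ->
  d a + d b - t0 - t <= #|saved r D|.
Proof.
move=> le_t frontP; have [dab dba] := spine_depth sp; have [_ _ da db mab] := sp.
have [small|big] := leqP (d a + d b - t) t0.+1.
  have : 0 < #|saved r D|.
    by apply/card_gt0P; exists (lev a t0.+1); apply: guard_saved; rewrite meet_lev.
  lia.
have {}frontP := frontP big.
have gP : lev a t0.+1 \in protected D t.+1 by apply/protectedP; exists t0.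
(* These are the vertices whose foot lies on the cycle arc between the guard and the front; the two
   guarded ends are the only exits. *)
pose X := [set x | (t0 < meet a x) && (meet a x + t <= d a + d b) || (t < meet b x)].
have sub : X \subset saved r D.
  apply: (saved_barrier (s := t)).
    apply/pred0P => x /=; apply/negbTE/negP => /andP [xX /burning_psi [mx]].
    move: xX; rewrite inE /psi; have := @spine_excl a b x sp.
    have := meet_le_l a x; have := meet_le a x.
    have := meet_le b x.
    by case: (leqP (meet a x) t0); lia.
  move=> x y xX xP xy; have excl := @spine_excl a b x sp.
  have [ma mb] := (meet_le_l a x, meet_le_l b x).
  have [ma' mb'] := (meet_le a x, meet_le b x).
  (* An unprotected [x] is neither the guard nor the front, in either of its two forms; these facts
     feed the case analysis on the edge [x y]. *)
  have ng : ~ (meet a x = t0.+1 /\ d x = t0.+1).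
    move=> [mx dx]; case/negP: xP; have -> // : x = lev a t0.+1.
    by rewrite -dx -meet_top ?mx.
  have nf : ~ (t < d b /\ meet b x = t.+1 /\ d x = t.+1).
    move=> [lt_tb [mx dx]]; case/negP: xP; move: frontP; rewrite /front lt_tb.
    by rewrite -dx -meet_top ?mx.
  have nf' : ~ (d b <= t /\ meet a x = d a + d b - t /\ d x = d a + d b - t).
    move=> [lt_tb [mx dx]]; case/negP: xP; move: frontP; rewrite /front ltnNge lt_tb /=.
    by rewrite -dx -meet_top ?mx.
  move: xX; rewrite !inE.
  case: (spine_edge sp xy) => [[_ _ dx ea eb]|[_ _ dy ea eb]|[xE yE]|[xE yE]].
  - by rewrite ea eb; lia.
  - have := meet_le_l a y; have := meet_le_l b y.
    by have := meet_le a y; have := meet_le b y; lia.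
  - subst x y; move: ng nf nf'; rewrite !meet_self // (meetC b a).
    by lia.
  - by subst x y; move: ng nf nf'; rewrite !meet_self // (meetC b a); lia.
apply: leq_trans (subset_leq_card sub).
apply: (@leq_trans ((minn (d a) (d a + d b - t) - t0) + (d b - t))); first by lia.
apply: (two_chains sp) => //; first exact: geq_minl.
- by move=> j lt_j le_j; rewrite inE meet_lev //; lia.
- by move=> j lt_j le_j; rewrite !inE (meet_lev le_j) lt_j orbT.
Qed.

End Guarded.

(** * What an arbitrary play with one early guard can save *)

Section Rival.
Variables (D : nat -> {set G}) (t1 t : nat).
Hypotheses (legD : legal r f D) (le_t01 : t0 <= t1) (le_t1 : t1 <= t).
Hypothesis one_guard : #|protected D t1| <= 1.

Lemma guard_uniq v w : v \in protected D t1 -> w \in protected D t1 -> v = w.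
Proof. by move=> vP wP; move/card_le1_eqP: one_guard => /(_ w v wP vP). Qed.

(** No guard stands between the foot of [u] and [u], so a fire that is at the foot in time reaches
    [u] by round [t]. Hence, unless [u] is late, the foot must have been out of reach during the
    first [t1] rounds. *)
Lemma late_foot a b u : spine a b -> u \notin burning r D t -> t0 < meet a u ->
  (forall p, p \in protected D t -> anc p u -> d p < meet a u) ->
  u \in late a b t \/
  meet a u + t1 <= d a + d b /\
  (t1 < meet a u \/ exists2 v, v \in protected D t1 & anc v (lev a (meet a u))).
Proof.
move=> sp unb; set j := meet a u => lt_j free.
have [dab dba] := spine_depth sp; have [ab _ da db mab] := sp.
have le_ja : j <= d a := meet_le_l a u.
have le_ju : j <= d u := meet_le a u.
pose c := lev a j; have dc : d c = j by rewrite d_lev.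
have cu : anc c u by rewrite meet_anc.
have ca : anc c a by apply: anc_lev.
have sub1 := subsetP (protected_mono D le_t1).
have free1 v : v \in protected D t1 -> anc v u -> d v < j by move/sub1; apply: free.
have spread s : c \in burning r D s -> s + (d u - j) <= t -> False.
  move=> cs le_s; case/negP: unb.
  apply: (subsetP (burning_mono r D le_s)); rewrite -dc.
  apply: (@burn_down D s t) => //; last by rewrite dc.
  move=> y cy yu _; apply/negP => /free /(_ yu); rewrite ltnNge -dc.
  by rewrite anc_le.
rewrite inE; have [lt_psi|le_psi] := ltnP t (psi a b u); first by left; rewrite orbT.
have le_u := leq_trans (psi_ge u sp) le_psi.
have psiE : psi a b u = (d a + d b).+1 + d u - 2 * j.
  by rewrite /psi -/j leqNgt lt_j.
right; have [exv|nov] := boolP [exists v in protected D t1, anc v c]; last first.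
  have nat_c : j <= t1 -> False.
    move=> le_jt; apply: (spread j); last by rewrite subnKC.
    rewrite -dc; apply: (burning_natural (t := t1)); first by rewrite dc.
    by move=> p pP; apply: contraNN nov => pc; apply/exists_inP; exists p.
  have lt_tj : t1 < j by rewrite ltnNge; apply/negP.
  split; last by left.
  by move: lt_tj le_ja dab; clear; lia.
case/exists_inP: exv => v vP vc; split; last by right; exists v.
have vu : anc v u by apply: anc_trans vc cu.
have va : anc v a by apply: anc_trans vc ca.
have lt_v : d v < j := free1 v vP vu.
have deep_v : t0 < d v by apply: protected_deep legD vP.
have nvb : ~~ anc v b.
  by apply/negP => /(anc_anc_meet va); rewrite leqNgt (leq_ltn_trans mab).
(* The single guard [v] is above [a] but not above [b]. If the bound failed, the fire would go down
   to [b], cross to [a] and climb to [c] within [t1] rounds, then descend to [u] by round [t]. *)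
rewrite leqNgt; apply/negP => lt_t.
have [bt ct le_psi'] : [/\ d b < t1, (d b).+1 + (d a - j) <= t1
    & (d b).+1 + (d a - j) + (d u - j) <= t].
  by move: lt_t le_psi; rewrite psiE; clear - le_ja le_ju; split; lia.
have b_burns : b \in burning r D (d b).
  apply: (burning_natural (t := t1)); first exact: ltnW.
  by move=> p pP; rewrite (guard_uniq pP vP).
have aP : a \notin protected D t1.
  by apply/negP => aP; move: lt_v; rewrite (guard_uniq vP aP) ltnNge le_ja.
have a_burns : a \in burning r D (d b).+1.
  by apply: (burning_step (t := t1) b_burns _ aP); [rewrite adj_sym|].
apply: (spread ((d b).+1 + (d a - j))) le_psi'.
rewrite -dc; apply: (burn_up (t := t1)) => //; last by rewrite dc.
move=> y cy ya _; apply/negP => yP; move: (anc_le cy).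
by rewrite (guard_uniq yP vP) leqNgt dc lt_v.
Qed.

(* The cycle vertices that can be unburnt after [t1] rounds if the only guard
   so far is not above [b]. *)
Definition remnant a b := chain a t0 (minn (d a) (d a + d b - t1)) :|: chain b t1 (d b).

Lemma card_remnant a b : spine a b -> #|remnant a b| <= d a + d b - t0 - t1.
Proof.
move=> sp; have [dab dba] := spine_depth sp; have [_ _ da db _] := sp.
apply: leq_trans (leq_card_setU _ _) _.
have := card_chain_le a t0 (minn (d a) (d a + d b - t1)).
by have := card_chain_le b t1 (d b); lia.
Qed.

(** Consider the deepest guard [p] above [u]. Either [u] is in the part hanging from [p], or the
    foot of [u] is a cycle vertex deeper than [p] and [late_foot] applies to its side. *)
Lemma unburnt_cover a b u : spine a b ->
  (forall v, v \in protected D t1 -> ~~ anc v b) -> u \notin burning r D t ->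
  u \in late a b t :|: late b a t
    :|: \bigcup_(p in protected D t) hang a b p
    :|: \bigcup_(c in remnant a b) hang a b c.
Proof.
move=> sp nb unb; have sp' := spine_sym sp.
rewrite !in_setU -!orbA; apply/or4P.
have [lt_tu|le_ut] := ltnP t (d u).
  by constructor 1; rewrite inE (leq_trans lt_tu (psi_ge u sp)) orbT.
have [p0 p0P p0u] := unburnt_guarded le_ut unb.
have [p /andP [pP pu] pmax] :=
  @arg_maxnP _ p0 (fun p => (p \in protected D t) && anc p u) d (introT andP (conj p0P p0u)).
have deep_p := protected_deep legD pP.
have free q : q \in protected D t -> anc q u -> d q <= d p.
  by move=> qP qu; apply: pmax; rewrite qP.
have hang_u x y j : spine x y -> j = meet x u -> t0 < j -> u \in hang x y (lev x j).
  move=> spx -> lt_j; apply: (subsetP (foot_core_hang spx lt_j (meet_le_l _ _))).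
  by rewrite inE.
have hangC c : hang b a c = hang a b c.
  by apply/setP => x; rewrite !inE; congr (_ && _); rewrite andbC.
have [le_a|lt_a] := leqP (meet a u) (d p).
  have [le_b|lt_b] := leqP (meet b u) (d p).
    by constructor 3; apply/bigcupP; exists p; rewrite ?inE ?pu ?le_a.
  have lt_j : t0 < meet b u := ltn_trans deep_p lt_b.
  have [|inl|[le_j [lt_t|[v vP vc]]]] := late_foot sp' unb lt_j.
  - by move=> q qP /(free q qP) le_q; apply: leq_ltn_trans le_q lt_b.
  - by constructor 2.
  - constructor 4; apply/bigcupP; exists (lev b (meet b u)).
      apply/setUP; right; apply/chainP; exists (meet b u); split=> //.
      exact: meet_le_l.
    by rewrite -hangC; apply: hang_u.
  - case/negP: (nb v vP); apply: anc_trans vc _.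
    exact/anc_lev/meet_le_l.
have lt_j : t0 < meet a u := ltn_trans deep_p lt_a.
have [|inl|[le_j _]] := late_foot sp unb lt_j.
- by move=> q qP /(free q qP) le_q; apply: leq_ltn_trans le_q lt_a.
- by constructor 1.
- constructor 4; apply/bigcupP; exists (lev a (meet a u)); last exact: hang_u.
  apply/setUP; left; apply/chainP; exists (meet a u); split=> //.
  by rewrite leq_min meet_le_l /=; lia.
Qed.

Lemma remnant_deep a b c : spine a b -> c \in remnant a b -> t0 < d c.
Proof.
move=> sp; have [_ _ da db _] := sp.
case/setUP => /chainP [j [lt_j le_j ->]]; rewrite d_lev //; lia.
Qed.

Lemma rival_bound a b M : spine a b ->
  (forall p X, core p X -> #|X| <= M) ->
  #|saved r D| <= #|late a b t| + #|late b a t|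
     + #|protected D t| * M + (d a + d b - t0 - t1) * M.
Proof.
(* The bound is symmetric in [a] and [b], and a single guard deeper than [t0] cannot be above
   both. *)
wlog nb : a b / (forall v, v \in protected D t1 -> ~~ anc v b).
  move=> wl sp; have [exb|nob] := boolP [exists v in protected D t1, anc v b]; last first.
    apply: wl => // v vP; apply: contraNN nob => vb; apply/exists_inP; by exists v.
  move=> coreM; rewrite [#|late a b t| + _]addnC [d a + _]addnC.
  apply: wl => //; last exact: spine_sym.
  case/exists_inP: exb => v vP vb w wP; rewrite (guard_uniq wP vP).
  have [_ _ _ _ mab] := sp; apply/negP => /anc_anc_meet /(_ vb).
  by rewrite leqNgt (leq_ltn_trans mab) // (protected_deep legD vP).
move=> sp coreM.
have leM c : t0 < d c -> #|hang a b c| <= M by move=> /(hang_core sp) /coreM.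
apply: (@leq_trans #|late a b t :|: late b a t
    :|: \bigcup_(p in protected D t) hang a b p
    :|: \bigcup_(c in remnant a b) hang a b c|).
  apply/subset_leq_card/subsetP => u /savedP /(_ t).
  exact: unburnt_cover.
apply: leq_trans (leq_card_setU _ _) _; apply: leq_add.
  apply: leq_trans (leq_card_setU _ _) _; apply: leq_add.
    exact: leq_card_setU.
  by apply: card_bigcup_leq => p /(protected_deep legD) /leM.
apply: leq_trans (card_bigcup_leq (m := M) _) _.
  by move=> c /(remnant_deep sp) /leM.
by rewrite leq_mul2r card_remnant // orbT.
Qed.

End Rival.

(** * Choosing the side to guard first *)

Lemma remaining_late a b t : spine a b -> t0 <= t ->
  d a + d b - t0 - t <= #|late a b t|.
Proof.
move=> sp le_t; have [dab dba] := spine_depth sp; have [_ _ da db _] := sp.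
apply: (@leq_trans ((minn (d a) (d a + d b - t) - t0) + (d b - t))); first by lia.
apply: (two_chains sp) => //; first exact: geq_minl.
- move=> j lt_j; rewrite leq_min => /andP [le_ja le_j].
  rewrite inE /psi meet_lev // d_lev //; case: (leqP j t0); lia.
- move=> j lt_j le_j; rewrite inE /psi.
  have /(spine_excl (spine_sym sp)) -> : t0 < meet b (lev b j) by rewrite meet_lev //; lia.
  by rewrite d_lev // lt_j orbT.
Qed.

Lemma late_guard a b t : spine a b -> 0 < #|late a b t|.
Proof.
move=> [_ _ da _ _]; apply/card_gt0P; exists (lev a t0.+1).
by rewrite inE meet_lev ?eqxx.
Qed.

Lemma late_mono a b s t : s <= t -> late a b t \subset late a b s.
Proof.
move=> le_st; apply/subsetP => x; rewrite !inE => /orP [->//|lt_t].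
by rewrite (leq_ltn_trans le_st lt_t) orbT.
Qed.

Lemma depth_below_foot a x : d x - meet a x < #|foot_core a (meet a x)|.
Proof.
have le_m := meet_le a x.
apply: (@leq_trans #|[set lev x (meet a x + i) | i : 'I_(d x - meet a x).+1]|).
  rewrite card_imset ?card_ord // => i j /(congr1 d).
  have [li lj] := (ltn_ord i, ltn_ord j).
  by rewrite !d_lev //; try lia; move=> eij; apply: val_inj => /=; lia.
apply/subset_leq_card/subsetP => y /imsetP [i _ ->]; rewrite inE.
by have li := ltn_ord i; rewrite meet_lev_deep //; lia.
Qed.

Lemma core_size_gt0 a b M : spine a b ->
  (forall p X, core p X -> #|X| <= M) -> 0 < M.
Proof.
move=> sp coreM; have [_ _ da _ _] := sp.
have := coreM _ _ (hang_core sp (_ : t0 < d (lev a t0.+1))); rewrite d_lev //.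
by move=> /(_ (ltnSn _)); apply: leq_trans; apply/card_gt0P; exists (lev a t0.+1);
  rewrite inE anc_refl !meet_le.
Qed.

(* A vertex that is late when [b] is guarded but not when [a] is guarded lies
   behind a cycle vertex that the fire coming through [a] reaches at most [M]
   rounds before [t]; there are not many more of these than cycle vertices
   left at time [t]. *)
Lemma late_swap a b t M : spine a b -> t0 <= t ->
  (forall p X, core p X -> #|X| <= M) ->
  #|late b a t| <= #|late a b t| + (#|late a b t| + M) * M.
Proof.
move=> sp le_t coreM; have sp' := spine_sym sp.
have [dab dba] := spine_depth sp; have [_ _ da db _] := sp.
have footM j : t0 < j -> j <= d b -> #|foot_core b j| <= M.
  move=> lt_j le_j; apply: leq_trans (subset_leq_card (foot_core_hang sp' lt_j le_j)) _.
  by apply: coreM (hang_core sp' _); rewrite d_lev.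
have M_gt0 := core_size_gt0 sp coreM.
(* The value [t0.+1] accounts for the foot guarded above [b]. For other feet, [t < psi b a x] and
   [d x - meet b x < M] give [meet b x <= d a + d b - t + M]. *)
pose C := chain b t0 (minn (d b) (maxn t0.+1 (d a + d b - t + M))).
have cover : late b a t \subset late a b t :|: \bigcup_(c in C) foot_core b (d c).
  apply/subsetP => x xb; rewrite in_setU; have [//|xa] := boolP (x \in late a b t).
  move: xb xa; rewrite !inE negb_or -leqNgt => xb /andP [ma le_psi].
  have le_x := leq_trans (psi_ge x sp) le_psi.
  have [le_m|lt_m] := leqP (meet b x) t0.
    by move: xb; rewrite /psi le_m; lia.
  have le_mb := meet_le_l b x.
  apply/bigcupP; exists (lev b (meet b x)); last by rewrite inE d_lev.
  apply/chainP; exists (meet b x); split=> //; rewrite leq_min le_mb /=.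
  have := leq_trans (depth_below_foot b x) (footM _ lt_m le_mb).
  have := meet_le b x.
  by move: xb; rewrite /psi (leqNgt (meet b x)) lt_m /=; lia.
apply: leq_trans (subset_leq_card cover) _.
apply: leq_trans (leq_card_setU _ _) _; rewrite leq_add2l.
apply: leq_trans (card_bigcup_leq (m := M) _) _.
  by move=> c /chainP [j [lt_j le_j ->]]; rewrite d_lev; [apply: footM|]; lia.
rewrite leq_mul2r; apply/orP; right; apply: leq_trans (card_chain_le _ _ _) _.
by have := remaining_late sp le_t; lia.
Qed.

(** From [3 * M * y' < x' <= x] follows [M <= x], so the last bound yields
    [y <= x + 2 * M * x <= 3 * M * x]. This fixes the factor [3 * M]. *)
Lemma side_arith (M x y x' y' : nat) : 0 < M -> 3 * M * x < y -> 3 * M * y' < x' ->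
  x' <= x -> 0 < y' -> y <= x + (x + M) * M -> False.
Proof.
move=> M_gt0 lt_y lt_x' le_x' y'_gt0 le_y.
have le_Mx : M <= x by nia.
by have := leq_mul le_Mx (leqnn M); have := leq_mul M_gt0 (leqnn x); lia.
Qed.

(** Suppose each side fails at some time. Since [late] shrinks with time, the later failure makes
    the smaller set at the earlier failure have at least [M] elements, and then [late_swap]
    contradicts that failure. *)
Lemma good_side a b M : spine a b -> (forall p X, core p X -> #|X| <= M) ->
  (forall t, t0 <= t -> #|late b a t| <= 3 * M * #|late a b t|) \/
  (forall t, t0 <= t -> #|late a b t| <= 3 * M * #|late b a t|).
Proof.
move=> sp coreM; have sp' := spine_sym sp.
apply: contrapT => /not_orP [/existsNP [s /not_implyP [le_s /negP]]].
rewrite -ltnNge => bad_s /existsNP [t /not_implyP [le_t /negP]].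
rewrite -ltnNge => bad_t.
have mono x y i j := fun le_ij => subset_leq_card (@late_mono x y i j le_ij).
have [le_st|lt_ts] := leqP s t.
  exact: side_arith (core_size_gt0 sp coreM) bad_s bad_t (mono _ _ _ _ le_st)
    (late_guard _ sp') (late_swap sp le_s coreM).
exact: side_arith (core_size_gt0 sp coreM) bad_t bad_s (mono _ _ _ _ (ltnW lt_ts))
  (late_guard _ sp) (late_swap sp' le_t coreM).
Qed.

Lemma protected_before D : legal r f D -> protected D t0 = set0.
Proof.
move=> legD; apply/eqP; rewrite -cards_eq0 -leqn0.
by apply: leq_trans (card_protected t0 legD) _; rewrite big1 // => i _; apply: f_t0.
Qed.

(** Here [t1] is the round in which the second firefighter comes, cut off at [t]; it equals [t0] if
    two come at once. *)
Lemma second_firefighter t : t0 <= t -> exists t1,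
  [/\ t0 <= t1, t1 <= t, \sum_(s < t1) f s <= 1
    & t1 = t \/ t1 < t /\ 1 < \sum_(s < t1.+1) f s].
Proof.
move=> le_t; have [le1|gt1] := leqP (\sum_(s < t) f s) 1; first by exists t; split; auto.
have ex_t : exists i, 1 < \sum_(s < i) f s by exists t.
case: (ex_minnP ex_t) => -[|t1] gt_t1 t1_min; first by rewrite big_ord0 in gt_t1.
have le_t1 := t1_min t gt1.
exists t1; split; [|exact: ltnW| |by right].
  rewrite leqNgt; apply: contraTN gt_t1 => lt_t1; rewrite big1 // => i _.
  by apply: f_t0; have := ltn_ord i; lia.
by rewrite leqNgt; apply/negP => /t1_min; rewrite ltnn.
Qed.

Lemma spine_play a b M D D' : spine a b -> (forall p X, core p X -> #|X| <= M) ->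
  (forall t, t0 <= t -> #|late b a t| <= 3 * M * #|late a b t|) ->
  0 < f t0 -> legal r f D -> follows (fun t => [:: lev a t0.+1; front a b t]) D ->
  legal r f D' -> #|saved r D'| <= (6 * M).+1 * #|saved r D|.
Proof.
move=> sp coreM side f_gt0 legD folD legD'; have [_ _ da db _] := sp.
have [t [le_t unb Df]] := exhausted legD folD.
have guard : lev a t0.+1 \in D t0.
  rewrite folD //; apply: pick_first_head => //.
  rewrite !inE protected_before // inE; apply/negP => /burning_depth.
  by rewrite d_lev // ltnn.
have [t1 [le_t01 le_t1 sum1 t1_case]] := second_firefighter le_t.
have one_guard : #|protected D' t1| <= 1 by apply: leq_trans (card_protected t1 legD') sum1.
have le_late := subset_leq_card (late_saved sp guard unb).
have remaining : d a + d b - t0 - t1 <= #|saved r D|.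
  case: t1_case => [->|[lt_t1 sum2]].
    exact: leq_trans (remaining_late sp le_t) le_late.
  apply: (front_saved sp guard le_t01) => lt_front.
  have frontB := front_unburnt sp guard le_t01 lt_front.
  have [frontP|frontP] := boolP (front a b t1 \in protected D t1).
    exact: (subsetP (protected_mono D (leqnSn t1))).
  apply/protectedP; exists t1 => //; rewrite (folD _ le_t01).
  apply: pick_first_second; last by rewrite !inE (negbTE frontP).
  rewrite big_ord_recr /= in sum2.
  (* If two firefighters come at [t0], the guard takes one and the front the other; later the guard
     is already protected and the front comes first. *)
  have [t1E|lt_t01] := leqP t1 t0.
    have t1t0 : t1 = t0 by apply/eqP; rewrite eqn_leq t1E.
    move: sum2; rewrite t1t0 big1 => [|i _]; last exact: f_t0.
    by apply: leq_ltn_trans; case: (_ \in _).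
  have -> : (lev a t0.+1 \in ~: (protected D t1 :|: burning r D t1)) = false.
    by rewrite !inE (_ : _ \in protected D t1) //; apply/protectedP; exists t0.
  move: sum2 sum1; rewrite ltnNge => sum2 sum1; rewrite lt0n; apply: contraNneq sum2 => ->.
  by rewrite addn0.
have := rival_bound legD' le_t01 le_t1 one_guard sp coreM.
have := side t le_t; have := card_opt_protected legD legD' Df.
move: le_late remaining; clear.
move: #|late a b t| #|late b a t| #|saved r D| #|saved r D'| => x y s s'.
move: #|protected D' t| (d a + d b - t0 - t1) => p z h1 h2 h3 h4 h5.
(* As [x], [p], [z] are at most [s] and [y <= 3 * M * x], the rival saves at most
   [(5 * M + 1) * s]. *)
have := leq_mul2l M x s; have := leq_mul2l M p s; have := leq_mul2l M z s.
by rewrite h1 h2 h3 !orbT; nia.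
Qed.

(** If only tree edges left [desc p], it would be a core, of size at most [M]. So the extra edge
    [a b] leaves it, and its ends are deep enough. *)
Lemma spine_exists p M : one_almost_tree G -> (forall p X, core p X -> #|X| <= M) ->
  t0 < d p -> M < #|desc p| -> exists a b, spine a b.
Proof.
move=> almost coreM deep_p big.
have step q x y : tree_edge r par x y -> anc q x -> x != q -> anc q y.
  case/orP => /andP [nr /eqP <-] qx xq; first exact: anc_par.
  by move: qx xq => qx _; rewrite anc_child.
have desc_core q : t0 < d q ->
    (forall x y, anc q x -> adj x y -> ~~ tree_edge r par x y -> anc q y) ->
    #|desc q| <= M.
  move=> dq cl; apply: (coreM q); split; first by rewrite inE anc_refl.
    by move=> x; rewrite inE => /anc_le; apply: leq_trans.
  move=> x y; rewrite !inE => qx xq xy.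
  by have [te|/(cl x y qx xy)//] := boolP (tree_edge r par x y); apply: step te qx xq.
have [a [b [pa ap ab nab npb]]] : exists a b,
    [/\ anc p a, a != p, adj a b, ~~ tree_edge r par a b & ~~ anc p b].
  apply: contrapT => none; move: big; rewrite ltnNge; apply/negP; rewrite negbK.
  apply: (coreM p); split; first by rewrite inE anc_refl.
    by move=> x; rewrite inE => /anc_le; apply: leq_trans.
  move=> x y; rewrite !inE => px xp xy; apply: contrapT => /negP npy; apply: none.
  exists x, y; split=> //; apply: contraNN npy => te; exact: step te px xp.
have ext := extra_edge_uniq almost d_root parP ab nab.
have lt_pa : d p < d a.
  rewrite ltn_neqAle (anc_le pa) andbT; apply: contraNneq ap => dpa.
  by case/ancP: pa => _ <-; rewrite dpa lev_d.
have dab : d a <= (d b).+1 by apply: d_adj; rewrite adj_sym.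
exists a, b; split=> //; try lia.
  move=> x y xy; have [te|nte] := boolP (tree_edge r par x y); first by constructor 1.
  by case: (ext x y xy nte) => h; [constructor 2|constructor 3].
(* If [a] and [b] met at [w] deeper than [t0], the extra edge would stay inside [desc w], making it
   a core that contains [desc p]. *)
rewrite leqNgt; apply/negP => lt_m.
pose w := lev a (meet a b); have dw : d w = meet a b by rewrite d_lev // meet_le_l.
have wa : anc w a by apply: anc_lev; apply: meet_le_l.
have wb : anc w b by rewrite meet_anc // meet_le_l.
have [le_pw|lt_wp] := leqP (d p) (d w).
  by case/negP: npb; apply: anc_trans (anc_total pa wa le_pw) wb.
have wp : anc w p := anc_total wa pa (ltnW lt_wp).
move: big; rewrite ltnNge; apply/negP; rewrite negbK.
apply: leq_trans (desc_core w _ _); last 2 first.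
- by rewrite dw.
- by move=> x y _ xy nte; case: (ext x y xy nte) => -[_ ->].
apply/subset_leq_card/subsetP => x; rewrite !inE; exact: anc_trans.
Qed.

End Tree.

(** * The algorithm and its competitive ratio *)

Lemma strategy_exists (G : sgraph) (r : G) (t0 : nat) : one_almost_tree G ->
  exists prio : nat -> seq G, forall f D D',
    (forall i, i < t0 -> f i = 0) -> 0 < f t0 ->
    legal r f D -> follows r t0 f prio D -> legal r f D' ->
    exists M, #|G| <= M ^ 2 /\ M <= #|saved r D| \/
              M ^ 2 <= #|G| /\ #|saved r D'| <= (6 * M).+1 * #|saved r D|.
Proof.
move=> almost; have [conG _] := almost.
have [d [par [d0 parP d_adj]]] := bfs_tree r conG.
pose isC (X : {set G}) := `[< exists p, core d t0 p X >].
pose M := \max_(X : {set G} | isC X) #|X|.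
have coreM p X : core d t0 p X -> #|X| <= M.
  by move=> cX; apply: (@leq_bigmax_cond _ isC (fun X => #|X|)); apply/asboolP; exists p.
have [le_n|lt_n] := leqP #|G| (M ^ 2).
  have [|X /asboolP [p cX] MX] := @eq_bigmax_cond _ isC (fun X : {set G} => #|X|).
    (* A core exists: otherwise [M] is 0, while the graph has at least one vertex. *)
    rewrite lt0n; apply/negP => /eqP /card0_eq none.
    have M0 : M = 0 by rewrite /M big_pred0.
    by have := max_card (pred1 r); rewrite card1; move: le_n; rewrite M0; lia.
  exists (fun=> [:: p]) => f D D' f0 f_gt0 legD folD legD'; exists M; left; split=> //.
  rewrite /M MX; apply: subset_leq_card; apply: (core_saved d0 d_adj cX).
  have [pX deepX _] := cX.
  rewrite folD //; apply: pick_first_head => //.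
  rewrite !inE (protected_before f0 legD) inE; apply/negP => /(burning_depth d0 d_adj).
  by rewrite leqNgt deepX.
have [small|] := pselect (forall p, t0 < d p -> #|desc d par p| <= M).
  exists (fun=> [::]) => f D D' f0 _ legD folD legD'; exists M; right.
  split; first exact: ltnW.
  apply: leq_trans (desc_bound d0 parP d_adj f0 legD folD legD' small) _.
  by rewrite leq_mul2r; apply/orP; right; lia.
move/existsNP => [p /not_implyP [deep_p /negP]]; rewrite -ltnNge => big.
have [a0 [b0 sp0]] := spine_exists d0 parP d_adj almost coreM deep_p big.
have [a [b [sp side]]] : exists a b, spine r d par t0 a b /\
    forall t, t0 <= t -> #|late d par t0 b a t| <= 3 * M * #|late d par t0 a b t|.
  have [side|side] := good_side d0 parP d_adj sp0 coreM; first by exists a0, b0.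
  by exists b0, a0; split=> //; apply: spine_sym sp0.
exists (fun t => [:: lev d par a t0.+1; front d par a b t]).
move=> f D D' f0 f_gt0 legD folD legD'; exists M; right; split; first exact: ltnW.
exact: (spine_play d0 parP d_adj f0 sp coreM side f_gt0 legD folD legD').
Qed.

(** The lists are chosen before [f], from [G], [r] and [t0] alone, so the algorithm can compute them
    when the first firefighter comes. *)
Definition strategy (G : sgraph) (r : G) (t0 : nat) : nat -> seq G :=
  if pselect (one_almost_tree G) is left almost
  then projT1 (cid (strategy_exists r t0 almost)) else fun=> [::].

Lemma unfought_fire (G : sgraph) (r : G) f D : graph_connected G ->
  (forall i, f i = 0) -> legal r f D -> saved r D = set0.
Proof.
move=> conG f0 legD; have [d [par [d0 parP d_adj]]] := bfs_tree r conG.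
apply/setP => u; rewrite [RHS]inE; apply/negP => /savedP /(_ (d u)) ub.
have [p pP _] := unburnt_guarded d0 parP (leqnn _) ub.
(* Every [t0] precedes the first firefighter here; [t0 := d p] gives [d p < d p]. *)
have := protected_deep d0 parP (t0 := d p) (fun i _ => f0 i) legD pP.
by rewrite ltnn.
Qed.

(** Once a firefighter has come, [find] gives the round of the first one; until then nothing is
    placed, whatever the list. *)
Definition sqrt_algorithm : online_algorithm :=
  priority_algorithm (fun G r s => strategy r (find (fun k => k != 0) s) (size s).-1).

Lemma sqrt_algorithm_bound (G : sgraph) (r : G) f D' : one_almost_tree G ->
  legal r f D' -> saved r D' != set0 ->
  exists M, #|G| <= M ^ 2 /\ M <= ALG sqrt_algorithm r f \/
            M ^ 2 <= #|G| /\ #|saved r D'| <= (6 * M).+1 * ALG sqrt_algorithm r f.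
Proof.
move=> almost legD' nz; have [conG _] := almost.
have ex_f : exists i, f i != 0.
  apply: contrapT => /forallNP f0; case/negP: nz; apply/eqP.
  by apply: unfought_fire legD' => // i; apply/eqP; have /negP := f0 i; rewrite negbK.
case: (ex_minnP ex_f) => t0 ft0 t0_min.
have f0 i : i < t0 -> f i = 0.
  by move=> lt_i; apply/eqP; apply: contraTT lt_i => /t0_min; rewrite -leqNgt.
have findE i : t0 <= i -> find (fun k => k != 0) (mkseq f i.+1) = t0.
  move=> le_i; rewrite /mkseq find_map; apply/eqP; rewrite eqn_leq; apply/andP; split.
    rewrite leqNgt; apply/negP => /(before_find 0).
    by rewrite nth_iota //= add0n ft0.
  rewrite leqNgt; apply/negP => lt_f.
  have hasF : has (preim f (fun k => k != 0)) (iota 0 i.+1).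
    by apply/hasP; exists t0; rewrite ?mem_iota.
  have := nth_find 0 hasF; rewrite nth_iota ?add0n; first by rewrite /= f0 ?eqxx.
  by apply: leq_trans lt_f _; apply: leqW.
rewrite /ALG play_priority; set D := move _ _ f.
have [prio [stratE prioP]] : exists prio, strategy r t0 = prio /\ forall f D D',
    (forall i, i < t0 -> f i = 0) -> 0 < f t0 ->
    legal r f D -> follows r t0 f prio D -> legal r f D' ->
    exists M, #|G| <= M ^ 2 /\ M <= #|saved r D| \/
              M ^ 2 <= #|G| /\ #|saved r D'| <= (6 * M).+1 * #|saved r D|.
  rewrite /strategy; case: pselect => // almost'.
  by exists (projT1 (cid (strategy_exists r t0 almost'))); split=> //; case: cid.
apply: (prioP f D D') => //; rewrite ?lt0n //; first exact: move_legal.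
by move=> i le_i; rewrite {1}/D moveE -/D findE // size_mkseq stratE.
Qed.

Lemma OPT_le (R : realType) (G : sgraph) (r : G) f (C : R) : (0 <= C)%R ->
  (forall D, legal r f D -> (#|saved r D|%:R <= C)%R) -> ((OPT r f)%:R <= C)%R.
Proof.
move=> C0 leC; rewrite /OPT; elim/big_ind: _ => [//|m n mC nC|k /asboolP [D legD <-]].
  by rewrite /maxn; case: ifP.
exact: leC.
Qed.

Lemma sqrt_competitive (R : realType) :
  competitive_on one_almost_tree sqrt_algorithm
    (fun n : nat => 6 * Num.sqrt (n%:R : R) + 1)%R.
Proof.
move=> G almost r f; set n := #|G|; set S := ALG _ r f.
have sqrt0 : (0 <= Num.sqrt (n%:R : R))%R := sqrtr_ge0 _.
have sqrtK : (Num.sqrt (n%:R : R) ^+ 2 = n%:R)%R by rewrite sqr_sqrtr.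
have S0 : (0 <= S%:R :> R)%R by [].
have coef : (0 <= 6 * Num.sqrt (n%:R : R) + 1)%R by lra.
rewrite /=; apply: OPT_le => [|D legD]; first exact: mulr_ge0.
have [->|nz] := eqVneq (saved r D) set0; first by rewrite cards0 mulr_ge0.
have sqrtM (M : nat) : (Num.sqrt ((M ^ 2)%:R : R) = M%:R)%R.
  by rewrite natrX sqrtr_sqr ger0_norm.
have [M [[le_n le_M]|[le_M le_D]]] := sqrt_algorithm_bound almost legD nz.
  (* Here the algorithm saves at least the square root of [n], and no play saves more than [n]. *)
  have le_sM : (Num.sqrt (n%:R : R) <= M%:R)%R.
    by rewrite -sqrtM ler_wsqrtr // ler_nat.
  have le_sS : (Num.sqrt (n%:R : R) <= S%:R)%R by apply: le_trans le_sM _; rewrite ler_nat.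
  have le_Dn : (#|saved r D|%:R <= n%:R :> R)%R by rewrite ler_nat max_card.
  apply: (le_trans le_Dn); rewrite -[leLHS]sqrtK expr2; apply: ler_pM => //; lra.
have le_Ms : (M%:R <= Num.sqrt (n%:R : R))%R.
  by rewrite -sqrtM ler_wsqrtr // ler_nat.
apply: (@le_trans _ _ (((6 * M).+1 * S)%:R)%R); first by rewrite ler_nat.
by rewrite natrM -natr1 natrM ler_wpM2r //; lra.
Qed.

(** * The lower bound *)

Lemma next_neq_prev (T : eqType) (c : seq T) x :
  uniq c -> 2 < size c -> x \in c -> next c x != prev c x.
Proof.
move=> Uc sz xc; have [i p cE] := rot_to xc; apply/eqP => e.
have : next c (next c x) = x by rewrite e next_prev.
rewrite -!(next_rot i Uc) cE.
have : uniq (x :: p) by rewrite -cE rot_uniq.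
have : 2 < size (x :: p) by rewrite -cE size_rot.
case: p {cE} => [|y [|z p]] //= _; rewrite !inE !negb_or eqxx.
case/andP => /and3P [xy xz _] _; rewrite eq_sym (negbTE xy) eqxx => zx.
by rewrite zx eqxx in xz.
Qed.

Lemma leq_OPT (G : sgraph) (r : G) f D : legal r f D -> #|saved r D| <= OPT r f.
Proof.
move=> legD; have lt_s : #|saved r D| < #|G|.+1 by rewrite ltnS max_card.
by apply: (leq_bigmax_cond (Ordinal lt_s)); apply/asboolP; exists D.
Qed.

Lemma saved_adj (G : sgraph) (r : G) D u v :
  u \notin saved r D -> adj u v -> (forall i, v \notin D i) -> v \notin saved r D.
Proof.
move=> /savedP /existsNP [i /negP]; rewrite negbK => ui uv vD.
apply/savedP => /(_ i.+1) /negP; apply; apply: (burning_step (t := i.+1) ui) => //.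
by apply/protectedP => -[j _]; apply/negP.
Qed.

Lemma root_unsaved (G : sgraph) (r : G) D : r \notin saved r D.
Proof. by apply/savedP => /(_ 0); rewrite burning_root. Qed.

Section Tadpole.
Variable k : nat.
Hypothesis k_gt1 : 1 < k.

Local Notation N := (k ^ 2 + k).+2.

(* The vertices below [k] form the path, the others the cycle. *)
Definition tadpole_adj : rel 'I_N := fun x y =>
  [|| y == x.+1 :> nat, x == y.+1 :> nat, (x == k :> nat) && (y == N.-1 :> nat)
    | (y == k :> nat) && (x == N.-1 :> nat)].

Lemma tadpole_sym : symmetric tadpole_adj.
Proof. by move=> x y; rewrite /tadpole_adj; lia. Qed.

Lemma tadpole_irrefl : irreflexive tadpole_adj.
Proof. by move=> x; rewrite /tadpole_adj; lia. Qed.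

Definition tadpole := SGraph tadpole_sym tadpole_irrefl.

Lemma tadpole_adjE (x y : tadpole) : adj x y -> [\/ y = x.+1 :> nat, x = y.+1 :> nat,
  (x = k :> nat) /\ (y = N.-1 :> nat) | (y = k :> nat) /\ (x = N.-1 :> nat)].
Proof.
case/or4P => [/eqP|/eqP|/andP [/eqP ? /eqP ?]|/andP [/eqP ? /eqP ?]];
  by [constructor 1|constructor 2|constructor 3|constructor 4].
Qed.

Lemma tadpole_adjS (x y : tadpole) : y = x.+1 :> nat -> adj x y.
Proof. by move=> yx; apply/or4P; constructor 1; apply/eqP. Qed.

Lemma tadpole_connected : graph_connected tadpole.
Proof.
have conn (x : tadpole) : connect (@adj tadpole) (ord0 : 'I_N) x.
  have [n] := ubnP x; elim: n x => // n IHn x lt_n.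
  case: (posnP x) => [x0|x_gt0].
    by have -> : x = ord0 :> 'I_N; [apply: val_inj|apply: connect0].
  have lt_y : x.-1 < N by have := ltn_ord x; lia.
  apply: connect_trans (IHn (Ordinal lt_y : 'I_N) _) _; first by rewrite /=; lia.
  by apply/connect1/tadpole_adjS; rewrite /= prednK.
move=> x y; apply: connect_trans (conn y).
by rewrite (sym_connect_sym (@adj_sym tadpole)).
Qed.

Section Cycle.
Variable c : seq tadpole.
Hypothesis cyc : simple_cycle c.

Lemma cycle_nbrs x : x \in c ->
  [/\ next c x \in c, prev c x \in c, adj x (next c x), adj x (prev c x)
    & next c x != prev c x :> nat].
Proof.
have [/andP [ec Uc] sz] := cyc => xc; rewrite mem_next mem_prev; split=> //.
- exact: next_cycle ec xc.
- rewrite adj_sym; exact: prev_cycle ec xc.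
- by apply: contraNneq (next_neq_prev Uc sz xc) => e; apply/eqP/val_inj.
Qed.

(** By induction from the free end of the path, both cycle neighbours of a vertex [x < k] would have
    to be [x.+1]. *)
Lemma cycle_off_tail x : x \in c -> k <= x.
Proof.
have [n] := ubnP x; elim: n x => // n IHn x lt_n xc; rewrite leqNgt; apply/negP => lt_k.
have [nc pc /tadpole_adjE nx /tadpole_adjE px np] := cycle_nbrs xc.
have nN : next c x = x.+1 :> nat.
  case: nx => [//|xn|[] xn _|[] _ xn]; try lia.
  have /IHn /(_ nc) : next c x < n by lia.
  lia.
have pN : prev c x = x.+1 :> nat.
  case: px => [//|xn|[] xn _|[] _ xn]; try lia.
  have /IHn /(_ pc) : prev c x < n by lia.
  lia.
by rewrite nN pN eqxx in np.
Qed.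

Lemma cycle_adj x y : x \in c -> adj x y -> k <= y -> y = next c x \/ y = prev c x.
Proof.
move=> xc xy ky; have [nc pc nx px np] := cycle_nbrs xc.
have kn := cycle_off_tail nc; have kp := cycle_off_tail pc; have kx := cycle_off_tail xc.
have [yn|yn] := eqVneq (y : nat) (next c x); first by left; apply: val_inj.
right; apply: (@ord_inj N); move: np yn.
have [? ?] := (ltn_ord y, ltn_ord x); have [? ?] := (ltn_ord (next c x), ltn_ord (prev c x)).
by case: (tadpole_adjE xy) (tadpole_adjE nx) (tadpole_adjE px) => h [] h' [] h''; lia.
Qed.

(** From any of its vertices the cycle must continue up to the last vertex, then to [k], and from
    there up through all the others. *)
Lemma cycle_full (x : tadpole) : k <= x -> x \in c.
Proof.
have step (y z : tadpole) : y \in c -> adj y z -> k <= z -> z \in c.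
  move=> yc yz kz; have [nc pc _ _ _] := cycle_nbrs yc.
  by case: (cycle_adj yc yz kz) => ->.
have up (y : tadpole) : k <= y -> y \in c -> forall z : tadpole, y <= z -> z \in c.
  move=> ky yc z; have [n] := ubnP z; elim: n z => // n IHn z lt_n le_yz.
  have [yz|lt_yz] := eqVneq (y : nat) z.
    by have <- : y = z by apply: val_inj.
  have lt_w : z.-1 < N by have := ltn_ord z; lia.
  apply: (step (Ordinal lt_w : 'I_N)); last by lia.
    by apply: IHn => /=; lia.
  by apply: tadpole_adjS => /=; lia.
have top : (ord_max : 'I_N) \in c.
  have [_ sz] := cyc; case E: c sz => [|y l] // _.
  have yc : y \in c by rewrite E mem_head.
  by rewrite -E; apply: up (cycle_off_tail yc) yc _ _; rewrite -ltnS; apply: ltn_ord.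
have lt_k : k < N by lia.
have rc : (Ordinal lt_k : 'I_N) \in c.
  by apply: (step (ord_max : 'I_N)) => //; apply/or4P; constructor 4; rewrite /= !eqxx.
exact: up rc x.
Qed.

End Cycle.

Lemma tadpole_one_almost : one_almost_tree tadpole.
Proof.
split=> [|c1 c2 cyc1 cyc2]; first exact: tadpole_connected.
have sub (c c' : seq tadpole) : simple_cycle c -> simple_cycle c' ->
    cycle_edges c \subset cycle_edges c'.
  move=> cyc cyc'; apply/subsetP => e /imsetP [x xc ->].
  have [nc _ nx _ _] := cycle_nbrs cyc xc.
  have xc' := cycle_full cyc' (cycle_off_tail cyc xc).
  case: (cycle_adj cyc' xc' nx (cycle_off_tail cyc nc)) => ->; first exact: imset_f.
  have [_ pc _ _ _] := cycle_nbrs cyc' xc'; have [/andP [_ Uc'] _] := cyc'.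
  by rewrite setUC -{2}(next_prev Uc' x); apply: imset_f.
by apply/eqP; rewrite eqEsubset !sub.
Qed.

(** * Plays on the tadpole *)

Lemma card_interval lo hi : hi <= N ->
  #|[set x : tadpole | lo <= (x : nat) < hi]| = hi - lo.
Proof.
move=> le_hi.
have -> : [set x : tadpole | lo <= (x : nat) < hi] =
    [set (inord (lo + i) : 'I_N) | i : 'I_(hi - lo)].
  apply/setP => x; rewrite inE; apply/idP/imsetP => [/andP [le_x lt_x]|[i _ ->]].
    have lt_i : x - lo < hi - lo by lia.
    by exists (Ordinal lt_i) => //; apply: val_inj; rewrite /= subnKC // inordK.
  by have lt_i := ltn_ord i; rewrite inordK; lia.
rewrite card_imset ?card_ord // => i j /(congr1 val).
have [li lj] := (ltn_ord i, ltn_ord j).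
by rewrite /= !inordK; try lia; move=> eij; apply: val_inj => /=; lia.
Qed.

Definition tadpole_root : tadpole := (inord k : 'I_N).
Local Notation r := tadpole_root.

Lemma val_root : r = k :> nat.
Proof. by rewrite inordK //; lia. Qed.

Lemma tail_unsaved (D : nat -> {set tadpole}) (x : tadpole) :
  (forall i (y : tadpole), y < k -> y \notin D i) -> x <= k -> x \notin saved r D.
Proof.
move=> free; have [n] := ubnP (k - x); elim: n x => // n IHn x lt_n le_x.
have [xk|xk] := eqVneq (x : nat) k.
  by have -> : x = r; [apply: val_inj; rewrite /= xk val_root|apply: root_unsaved].
have lt_y : x.+1 < N by lia.
apply: (@saved_adj tadpole _ _ (Ordinal lt_y : 'I_N)).
- by apply: IHn => /=; lia.
- by rewrite adj_sym; apply: tadpole_adjS.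
- by move=> i; apply: free; lia.
Qed.

Lemma unsaved_up (D : nat -> {set tadpole}) (x : tadpole) :
  (forall i (y : tadpole), k < y -> y <= x -> y \notin D i) ->
  k <= x -> x \notin saved r D.
Proof.
have [n] := ubnP x; elim: n x => // n IHn x lt_n free le_x.
have [xk|xk] := eqVneq (x : nat) k.
  by have -> : x = r; [apply: val_inj; rewrite /= xk val_root|apply: root_unsaved].
have lt_y : x.-1 < N by have := ltn_ord x; lia.
apply: (@saved_adj tadpole _ _ (Ordinal lt_y : 'I_N)).
- apply: IHn => /=; try lia.
  by move=> i y ky yx; apply: free => //; lia.
- by apply: tadpole_adjS => /=; lia.
- by move=> i; apply: free; lia.
Qed.

Lemma unsaved_down (D : nat -> {set tadpole}) (x : tadpole) :
  (forall i (y : tadpole), x <= y -> y \notin D i) -> x \notin saved r D.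
Proof.
have [n] := ubnP (N - x); elim: n x => // n IHn x lt_n free.
have [xN|xN] := eqVneq (x : nat) N.-1.
  apply: (saved_adj (root_unsaved r D)); last by move=> i; apply: free.
  by apply/or4P; constructor 3; rewrite val_root xN !eqxx.
have lt_y : x.+1 < N by have := ltn_ord x; lia.
apply: (@saved_adj tadpole _ _ (Ordinal lt_y : 'I_N)).
- apply: IHn => /=; first by lia.
  by move=> i y xy; apply: free; lia.
- by rewrite adj_sym; apply: tadpole_adjS.
- by move=> i; apply: free.
Qed.

(** A single guard on the cycle blocks at most one of the two arcs from the root to [x]. *)
Lemma cycle_unsaved (D : nat -> {set tadpole}) (x : tadpole) :
  (forall i j (y z : tadpole), k <= y -> k <= z -> y \in D i -> z \in D j -> y = z) ->
  k <= x -> (forall i, x \notin D i) -> x \notin saved r D.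
Proof.
move=> one kx xD.
have [[i [y [ky yx yD]]]|none] := pselect (exists i (y : tadpole), [/\ k < y, y <= x & y \in D i]).
  apply: unsaved_down => j z xz; apply/negP => zD.
  have yz := one i j y z (ltnW ky) (leq_trans kx xz) yD zD.
  have xy : x = y by apply: val_inj; apply/eqP; rewrite eqn_leq yx yz xz.
  by move: (xD i); rewrite xy yD.
apply: (unsaved_up _ kx) => i y ky yx; apply/negP => yD; apply: none.
by exists i, y; split.
Qed.

Lemma tadpole_OPT1 : k <= OPT r (fun i => i == 0).
Proof.
pose D i : {set tadpole} := if i == 0 then [set (inord k.-1 : 'I_N)] else set0.
have P1 : protected D 1 = [set (inord k.-1 : 'I_N)].
  by rewrite /protected !big_ord_recr big_ord0 /= set0U.
have vk : (inord k.-1 : 'I_N) = k.-1 :> nat by rewrite inordK //; lia.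
have legD : legal r (fun i => i == 0) D.
  case=> [|i]; rewrite /D /=; last by rewrite cards0 !disjoints_subset !sub0set.
  rewrite cards1 !disjoints_subset !sub1set !inE /protected big_ord0 inE; split=> //.
  by apply/eqP => /(congr1 val); rewrite /= vk val_root; lia.
apply: leq_trans (leq_OPT legD); rewrite -[X in X <= _]subn0 -(@card_interval 0 k); last by lia.
apply/subset_leq_card/(saved_barrier (s := 0)).
  rewrite disjoint_sym disjoints_subset sub1set !inE val_root; lia.
move=> x y; rewrite !inE P1 inE => /andP [_ lt_x] xk /tadpole_adjE xy.
have {}xk : x != k.-1 :> nat by apply: contraNneq xk => e; apply/eqP/val_inj; rewrite /= vk.
by case: xy => [?|?|[? ?]|[? ?]]; lia.
Qed.

Lemma tadpole_OPT2 : k ^ 2 <= OPT r (fun i => i < 2).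
Proof.
(* After the first round the fire has reached [N.-1], so the second guard stands just behind it,
   leaving [k ^ 2] cycle vertices enclosed. *)
pose D i : {set tadpole} := if i is 0 then [set (inord k.+1 : 'I_N)]
  else if i is 1 then [set (inord (k ^ 2 + k) : 'I_N)] else set0.
have k2 : 2 * k <= k ^ 2 by rewrite -mulnn leq_mul2r k_gt1 orbT.
have P1 : protected D 1 = [set (inord k.+1 : 'I_N)].
  by rewrite /protected !big_ord_recr big_ord0 /= set0U.
have P2 : protected D 2 = [set (inord k.+1 : 'I_N); (inord (k ^ 2 + k) : 'I_N)].
  by rewrite /protected !big_ord_recr big_ord0 /= set0U.
have v1 : (inord k.+1 : 'I_N) = k.+1 :> nat by rewrite inordK //; lia.
have v2 : (inord (k ^ 2 + k) : 'I_N) = k ^ 2 + k :> nat by rewrite inordK //; lia.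
have burn1 (x : tadpole) : x \in burning r D 1 ->
    [\/ x = k :> nat, x = k.-1 :> nat | x = N.-1 :> nat].
  case/burningSP => [|[xP [u]]]; rewrite inE => /eqP ->; first by constructor 1; exact: val_root.
  move=> /tadpole_adjE; rewrite val_root; case=> [e|e|[_ e]|[e _]]; last 3 first.
  - by constructor 2; lia.
  - by constructor 3.
  - by constructor 1.
  by case/negP: xP; rewrite P1 inE; apply/eqP/val_inj; rewrite /= v1.
have legD : legal r (fun i => i < 2) D.
  case=> [|[|i]].
  - rewrite -[D 0]/[set (inord k.+1 : 'I_N)] cards1 !disjoints_subset !sub1set.
    rewrite !inE /protected big_ord0 inE; split=> //.
    by apply/eqP => /(congr1 val); rewrite /= v1 val_root; lia.
  - rewrite -[D 1]/[set (inord (k ^ 2 + k) : 'I_N)] cards1 P1; split=> //;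
      rewrite disjoints_subset sub1set in_setC.
      by apply/negP => /burn1; rewrite v2 => -[]; lia.
    by rewrite inE; apply/eqP => /(congr1 val); rewrite /= v1 v2; lia.
  - by rewrite -[D i.+2]/set0 cards0 !disjoints_subset !sub0set.
apply: leq_trans (leq_OPT legD).
have -> : k ^ 2 = (k ^ 2 + k).+1 - k.+1 by lia.
rewrite -card_interval; last by lia.
apply/subset_leq_card/(saved_barrier (s := 1)).
  apply/pred0P => x /=; apply/negbTE/negP => /andP [].
  by rewrite inE => xI /burn1 [] e; move: xI; rewrite e; lia.
move=> x y; rewrite !inE P2 !inE negb_or => xI /andP [xk xN] /tadpole_adjE xy.
have {}xk : x != k.+1 :> nat by apply: contraNneq xk => e; apply/eqP/val_inj; rewrite /= v1.
have {}xN : x != k ^ 2 + k :> nat by apply: contraNneq xN => e; apply/eqP/val_inj; rewrite /= v2.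
by case: xy => [?|?|[? ?]|[? ?]]; lia.
Qed.

(** The first move depends on [[:: 1]] only, hence is common to both continuations. *)
Lemma tadpole_adversary (A : online_algorithm) : legal_on one_almost_tree A ->
  exists f, k <= OPT r f /\ ALG A r f <= 1 \/ k ^ 2 <= OPT r f /\ ALG A r f <= k.+1.
Proof.
move=> /(_ _ tadpole_one_almost r) legA.
have [/existsP [x /andP [xA xk]]|none] :=
    boolP [exists x : tadpole, (x \in A _ r [:: 1]) && (x < k)].
  exists (fun i => i < 2); right; split; first exact: tadpole_OPT2.
  rewrite /ALG; set D := play A r _; have legD : legal r (fun i => i < 2) D by apply: legA.
  have D0 y : y \in D 0 -> y = x.
    have [] := legD 0; rewrite /= => /card_le1_eqP h _ _ yD; exact: (h x y xA yD).
  have D2 i y : y \in D i.+2 -> False.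
    by have [] := legD i.+2; rewrite /= leqn0 cards_eq0 => /eqP -> _ _; rewrite inE.
  have D1 i y : y \in D i -> k <= y -> y \in D 1.
    by case: i => [/D0 -> |[|i] // /D2 //]; rewrite leqNgt xk.
  (* The round-0 guard is on the path, so at most one guard is on the cycle, and it saves only
     itself there. *)
  apply: (@leq_trans #|[set y : tadpole | 0 <= (y : nat) < k] :|: D 1|).
    apply/subset_leq_card/subsetP => y; apply: contraTT; rewrite in_setU negb_or.
    rewrite [y \in [set _ | _]]inE /= -leqNgt; case/andP => ky yD.
    apply: (cycle_unsaved _ ky) => [i j u v ku kv uD vD|i]; last first.
      by apply: contraNN yD => /D1; apply.
    have [] := legD 1; rewrite /= => /card_le1_eqP h _ _.
    exact: (h v u (D1 _ _ vD kv) (D1 _ _ uD ku)).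
  apply: leq_trans (leq_card_setU _ _) _; rewrite card_interval; last by lia.
  by rewrite subn0 -[k.+1]addn1 leq_add2l; have [] := legD 1.
exists (fun i => i == 0); left; split; first exact: tadpole_OPT1.
rewrite /ALG; set D := play A r _; have legD : legal r (fun i => i == 0) D by apply: legA.
have D1 i y : y \in D i -> y \in D 0.
  case: i => // i; have [] := legD i.+1; rewrite /= leqn0 cards_eq0 => /eqP -> _ _.
  by rewrite inE.
have D0 y : y \in D 0 -> k <= y.
  move=> yD; rewrite leqNgt; apply: contraNN none => lt_y.
  by apply/existsP; exists y; rewrite lt_y andbT.
apply: (@leq_trans #|D 0|); last by have [] := legD 0.
apply/subset_leq_card/subsetP => y; apply: contraTT => yD.
have [le_y|/ltnW ky] := leqP y k.
  by apply: (tail_unsaved _ le_y) => i z; rewrite ltnNge; apply: contraNN => /D1 /D0.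
apply: (cycle_unsaved _ ky) => [i j u v _ _ /D1 uD /D1 vD|i]; last first.
  by apply: contraNN yD => /D1.
have [] := legD 0; rewrite /= => /card_le1_eqP h _ _; exact: (h v u vD uD).
Qed.

End Tadpole.

Local Open Scope classical_set_scope.
Local Open Scope ring_scope.

Theorem theorem2 (R : realType) :
  (exists A : online_algorithm,
      legal_on one_almost_tree A /\
      competitive_on one_almost_tree A
        (fun n : nat => 6 * Num.sqrt (n%:R : R) + 1))
  /\
  (forall A : online_algorithm,
      legal_on one_almost_tree A ->
      ~ exists c : nat -> R,
          c =o_\oo (fun n : nat => Num.sqrt (n%:R : R)) /\
          competitive_on one_almost_tree A c).
Proof.
split.
  exists sqrt_algorithm; split; last exact: sqrt_competitive.
  by move=> G _ r f; rewrite play_priority; apply: move_legal.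
move=> A legA [c [/eqoP co comp]].
(* As [N <= (2 * k) ^ 2], the constant 1/8 gives [c N <= k / 4], too small for both ratios [k] and
   [k ^ 2 / (k + 1)]. *)
have [|n0 _ small] := co (8^-1); first by rewrite invr_gt0.
pose k := n0.+2; pose N := (k ^ 2 + k).+2.
have k_gt1 : (1 < k)%N by [].
have cardN : #|tadpole k_gt1| = N by rewrite card_ord.
have cN : 4 * c N <= k%:R.
  have le_N : (N <= (2 * k) ^ 2)%N by rewrite /N /k; nia.
  have le_sqrt : Num.sqrt (N%:R : R) <= 2 * k%:R.
    rewrite -[2 * k%:R]ger0_norm ?mulr_ge0 // -sqrtr_sqr ler_wsqrtr //.
    by rewrite -natrM -natrX ler_nat.
  have le_n0 : (n0 <= N)%N by rewrite /N /k; lia.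
  have := small N le_n0; rewrite /= (ger0_norm (sqrtr_ge0 _)) => le_c.
  have := le_trans (ler_norm (c N)) le_c; lra.
have k0 : 2 <= k%:R :> R by rewrite ler_nat.
have [f] := tadpole_adversary k_gt1 legA.
have := comp _ (tadpole_one_almost k_gt1) (tadpole_root k_gt1) f; rewrite cardN.
set O := OPT _ _; set S := ALG _ _ _ => bound.
have cS : O%:R <= k%:R / 4 * S%:R :> R.
  by apply: le_trans bound _; apply: ler_wpM2r => //; lra.
case=> -[le_O le_S].
  have : k%:R <= O%:R :> R by rewrite ler_nat.
  have : S%:R <= 1 :> R by rewrite lern1.
  by nra.
have : k%:R ^+ 2 <= O%:R :> R by rewrite -natrX ler_nat.
have : S%:R <= k%:R + 1 :> R by rewrite natr1 ler_nat.
by nra.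
Qed.
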